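(* Let $k\in\mathbb{N}$, let $G$ be a disconnected cactus graph in $\mathbf{obs}(\mathcal{A}_k(\mathcal{S}))$, and let $G_1,G_2,\dots,G_r$ be the connected components of $G$. Then one of the following holds: (i) $G\cong (k+2)K_3$; (ii) there is a sequence of positive integers $k_1,k_2,\dots,k_r$ such that $G_i\in\mathcal{Z}_{k_i}$ for every $i\in\{1,\dots,r\}$ and $\sum_{i=1}^r k_i=k+1$.
   Context: $\mathbb{N}=\{0,1,2,\dots\}$. All graphs are finite, undirected, without loops or multiple edges, and are considered up to isomorphism. $rG$ denotes $r$ disjoint copies of $G$. A graph $H$ is a minor of $G$ if $H$ can be obtained from some subgraph of $G$ by contracting edges. A graph is sub-unicyclic if it contains at most one cycle; $\mathcal{S}$ is the class of sub-unicyclic graphs. $\mathcal{A}_k(\mathcal{S})$ is the class of graphs $G$ for which some set of at most $k$ vertices can be removed to give a graph in $\mathcal{S}$. For a class $\mathcal{G}$, $\mathbf{obs}(\mathcal{G})$ is the set of minor-minimal graphs not in $\mathcal{G}$. A cactus graph is a graph all of whose blocks are edges or cycles. The butterfly graph $Z$ is obtained from two disjoint triangles by identifying a vertex of one with a vertex of the other; its central vertex is its vertex of degree 4, and its four vertices of degree 2 are its extremal vertices. The class $\mathcal{Z}_k$ ($k\ge1$) is defined recursively: $\mathcal{Z}_1=\{Z\}$; for $k\ge 2$, $G\in\mathcal{Z}_k$ if there is $G'\in\mathcal{Z}_{k-1}$ such that $G$ is obtained by taking a new copy of $Z$ and identifying one of its extremal vertices with a non-central vertex of $G'$. The central vertices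 of the resulting $G$ are the central vertices of $G'$ together with the central vertex of the new copy of $Z$. *)

(* Defs.v *)
From mathcomp Require Import all_boot.

Set Implicit Arguments.
Unset Strict Implicit.
Unset Printing Implicit Defensive.

Record sgraph := SGraph {
  vertex :> finType;
  edge : rel vertex;
  edge_sym : symmetric edge;
  edge_irrefl : irreflexive edge }.

Arguments edge {s} _ _.

Definition iso (G H : sgraph) : Prop :=
  exists2 f : G -> H, bijective f & {mono f : x y / edge x y}.

Definition degree (G : sgraph) (v : G) : nat := #|[set w | edge v w]|.

Definition edges (G : sgraph) : {set {set G}} :=
  [set [set p.1; p.2] | p : G * G & edge p.1 p.2].

Lemma edgesP (G : sgraph) (x y : G) : ([set x; y] \in edges G) = edge x y.
Proof.
apply/imsetP/idP => [[[a b]] /=|xy]; last first.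
  by exists (x, y); rewrite ?inE.
rewrite inE /= => ab eqs.
have a_neq_b : a != b by apply: contraTneq ab => ->; rewrite edge_irrefl.
have : a \in [set x; y] by rewrite eqs !inE eqxx.
have : b \in [set x; y] by rewrite eqs !inE eqxx orbT.
rewrite !inE => /orP[]/eqP eb /orP[]/eqP ea; move: ab a_neq_b; rewrite ea eb.
- by rewrite eqxx.
- by rewrite edge_sym.
- by [].
- by rewrite eqxx.
Qed.

Section Complete.
Variable n : nat.
Definition complete_edge : rel 'I_n := fun i j => i != j.
Fact complete_sym : symmetric complete_edge.
Proof. by move=> i j; rewrite /complete_edge eq_sym. Qed.
Fact complete_irrefl : irreflexive complete_edge.
Proof. by move=> i; rewrite /complete_edge eqxx. Qed.
Definition complete : sgraph := SGraph complete_sym complete_irrefl.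
End Complete.

(* [ordS] is the cyclic successor on 'I_n; this is the cycle C_n when n >= 3. *)
Section CycleGraph.
Variable n : nat.
Definition cycle_edge : rel 'I_n :=
  fun i j => (i != j) && ((j == ordS i) || (i == ordS j)).
Fact cycle_sym : symmetric cycle_edge.
Proof. by move=> i j; rewrite /cycle_edge eq_sym orbC. Qed.
Fact cycle_irrefl : irreflexive cycle_edge.
Proof. by move=> i; rewrite /cycle_edge eqxx. Qed.
Definition cycle_graph : sgraph := SGraph cycle_sym cycle_irrefl.
End CycleGraph.

Definition is_cycle (G : sgraph) : Prop :=
  exists2 n, 3 <= n & iso G (cycle_graph n).

Section Copies.
Variables (r : nat) (G : sgraph).
Definition copies_edge : rel ('I_r * G)%type :=
  fun p q => (p.1 == q.1) && edge p.2 q.2.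
Fact copies_sym : symmetric copies_edge.
Proof. by move=> p q; rewrite /copies_edge eq_sym edge_sym. Qed.
Fact copies_irrefl : irreflexive copies_edge.
Proof. by move=> p; rewrite /copies_edge edge_irrefl andbF. Qed.
Definition copies : sgraph := SGraph copies_sym copies_irrefl.
End Copies.

Section VertexRemoval.
Variables (G : sgraph) (X : {set G}).
Definition remove_edge : rel {v : G | v \notin X} :=
  fun u v => edge (val u) (val v).
Fact remove_sym : symmetric remove_edge.
Proof. by move=> u v; rewrite /remove_edge edge_sym. Qed.
Fact remove_irrefl : irreflexive remove_edge.
Proof. by move=> u; rewrite /remove_edge edge_irrefl. Qed.
Definition remove : sgraph := SGraph remove_sym remove_irrefl.
End VertexRemoval.

Record subgraph (G : sgraph) := Subgraph {
  sub_vertices : {set G};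
  sub_edges : {set {set G}};
  sub_edgesP : sub_edges \subset edges G;
  sub_endsP : [forall e in sub_edges, e \subset sub_vertices] }.

Section SubgraphGraph.
Variables (G : sgraph) (S : subgraph G).
Definition subgraph_edge : rel {v : G | v \in sub_vertices S} :=
  fun u v => [set val u; val v] \in sub_edges S.
Fact subgraph_sym : symmetric subgraph_edge.
Proof. by move=> u v; rewrite /subgraph_edge setUC. Qed.
Fact subgraph_irrefl : irreflexive subgraph_edge.
Proof.
move=> u; apply/negP => /(subsetP (sub_edgesP S)).
by rewrite edgesP edge_irrefl.
Qed.
Definition graph_of_subgraph : sgraph := SGraph subgraph_sym subgraph_irrefl.
End SubgraphGraph.

Coercion graph_of_subgraph : subgraph >-> sgraph.

Definition subgraph_le (G : sgraph) (S T : subgraph G) : Prop :=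
  sub_vertices S \subset sub_vertices T /\ sub_edges S \subset sub_edges T.

Definition maximal_subgraph (P : sgraph -> Prop) (G : sgraph) (S : subgraph G) :
    Prop :=
  P S /\ forall T : subgraph G, subgraph_le S T -> P T -> T = S.

(* The contracted edge is xy: y is merged into x. *)
Section Contraction.
Variables (G : sgraph) (x y : G).
Definition contract_edge : rel {v : G | v != y} := fun u v =>
  (u != v) && [|| edge (val u) (val v),
                  (val u == x) && edge y (val v)
                | (val v == x) && edge y (val u)].
Fact contract_sym : symmetric contract_edge.
Proof.
by move=> u v; rewrite /contract_edge eq_sym edge_sym; congr (_ && (_ || _)); rewrite orbC.
Qed.
Fact contract_irrefl : irreflexive contract_edge.
Proof. by move=> u; rewrite /contract_edge eqxx. Qed.
Definition contract : sgraph := SGraph contract_sym contract_irrefl.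
End Contraction.

Inductive contracts_to : sgraph -> sgraph -> Prop :=
| contracts_iso (G H : sgraph) : iso G H -> contracts_to G H
| contracts_step (G H : sgraph) (x y : G) :
    edge x y -> contracts_to (contract x y) H -> contracts_to G H.

Definition minor (H G : sgraph) : Prop :=
  exists S : subgraph G, contracts_to S H.

Definition sub_unicyclic (G : sgraph) : Prop :=
  forall S T : subgraph G, is_cycle S -> is_cycle T -> S = T.

Definition apex (k : nat) (C : sgraph -> Prop) (G : sgraph) : Prop :=
  exists2 X : {set G}, #|X| <= k & C (remove X).

Definition obs (C : sgraph -> Prop) (G : sgraph) : Prop :=
  ~ C G /\ forall H : sgraph, minor H G -> ~ C H -> iso H G.

(* The graph with no vertex is not connected. *)
Definition connected (G : sgraph) : Prop :=
  0 < #|G| /\ forall x y : G, connect edge x y.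

Definition component (G : sgraph) (S : subgraph G) : Prop :=
  maximal_subgraph connected S.

Definition num_components (G : sgraph) : nat := n_comp (@edge G) G.

Definition cut_vertex (G : sgraph) (v : G) : Prop :=
  num_components G < num_components (remove [set v]).

Definition nonseparable (G : sgraph) : Prop :=
  [/\ connected G, 1 < #|G| & forall v : G, ~ cut_vertex v].

(* Since nonseparable graphs have at least two vertices, an isolated vertex
   is not a block, so a cactus may have isolated vertices. *)
Definition block (G : sgraph) (S : subgraph G) : Prop :=
  maximal_subgraph nonseparable S.

Definition cactus (G : sgraph) : Prop :=
  forall S : subgraph G, block S -> iso S (complete 2) \/ is_cycle S.

(* Disjoint union of G and H with the vertex y of H identified with x. *)
Section Identify.
Variables (G : sgraph) (x : G) (H : sgraph) (y : H).
Definition identify_edge : rel (G + {w : H | w != y})%type := fun a b =>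
  match a, b with
  | inl u, inl v => edge u v
  | inr u, inr v => edge (val u) (val v)
  | inl u, inr v => (u == x) && edge y (val v)
  | inr u, inl v => (v == x) && edge y (val u)
  end.
Fact identify_sym : symmetric identify_edge.
Proof. by move=> [u|u] [v|v] //=; rewrite edge_sym. Qed.
Fact identify_irrefl : irreflexive identify_edge.
Proof. by move=> [u|u] /=; rewrite edge_irrefl. Qed.
Definition identify : sgraph := SGraph identify_sym identify_irrefl.
End Identify.

Definition butterfly : sgraph :=
  @identify (complete 3) ord0 (complete 3) ord0.

Definition butterfly_central : {set butterfly} := [set v | degree v == 4].
Definition butterfly_extremal : {set butterfly} := [set v | degree v == 2].

(* [butterfly_tree k G C]: G is built from k butterflies as in the recursive
   definition, and C is the set of its central vertices. *)
Inductive butterfly_tree : nat -> forall G : sgraph, {set G} -> Prop :=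
| butterfly_tree1 : butterfly_tree 1 butterfly_central
| butterfly_treeS (k : nat) (G : sgraph) (C : {set G})
    (v : G) (z : butterfly) :
    butterfly_tree k C -> v \notin C -> z \in butterfly_extremal ->
    @butterfly_tree k.+1 (identify v z)
      [set a : identify v z | match a with
                              | inl u => u \in C
                              | inr w => val w \in butterfly_central
                              end].

Definition Zclass (k : nat) (G : sgraph) : Prop :=
  exists (H : sgraph) (C : {set H}), @butterfly_tree k H C /\ iso G H.

(* Main.v *)
(* Let C be the set of vertex sets of cycles of G. In a cactus, a cycle together with
   a chain of other cycles joining two of its vertices would be nonseparable, hence
   lie in a block that is not a cycle; so C is Berge-acyclic. By induction on a leaf c
   of C, attached at t, there are a hitting set X of C, a packing of #|X| disjoint
   cycles, and either a set smaller than X meeting all cycles but one, or a system of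
   butterflies in C with set of centers X: let X' be the hitting set of the cycles
   avoiding t and X = X' + t; either X' misses only c, or X' misses a further cycle
   through t, which together with c forms a butterfly centered at t.
   If G is not in A_k(S), this yields k+2 disjoint cycles or a forest of k+1
   butterflies. Neither belongs to A_k(S) (in the second case the centers form the only
   hitting set of size k+1), and both survive the deletion of everything else and the
   contraction of an edge without center in a cycle of length at least 4. By
   minimality G is (k+2)K_3 or a forest of butterflies made of triangles. *)
Require Import Defs.
From mathcomp Require Import all_boot.
From Stdlib Require Import Classical.

Set Implicit Arguments.
Unset Strict Implicit.
Unset Printing Implicit Defensive.

(** * Berge-acyclic families of sets *)

(** Working with vertex sets instead of subgraphs lets one argument serve for deletion and for
    contraction: both act on a family of sets through a vertex map, and it remains to see which maps
    preserve packings and butterfly forests. A contraction could merge two centers or make two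
    cycles meet anew. Neither happens when the contracted edge avoids the centers and lies on a
    single cycle; since each cycle carries at most one center, a cycle of length at least 4 always
    has such an edge. Two descriptions of butterfly systems are needed. The dichotomy finds
    butterflies in no particular order, whereas hitting sets, images and the recursive class are all
    handled by induction along a construction order. Minimality only provides an isomorphism between
    a minor and [G], never an equality, so the conclusions about [G] itself are drawn by counting
    vertices and edges. *)

Section Hypergraph.
Variable V : finType.
Implicit Types (F B M : {set {set V}}) (Q R c P X Z : {set V}).

Definition adj F : rel V := fun u v => [exists Q in F, (u \in Q) && (v \in Q)].

(* No closed chain of members of [F]: the hypergraph [F] is Berge-acyclic. *)
Definition berge F := forall Q u v,
  Q \in F -> u \in Q -> v \in Q -> connect (adj (F :\ Q)) u v -> u = v.

Lemma adjP F u v :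
  reflect (exists Q, [/\ Q \in F, u \in Q & v \in Q]) (adj F u v).
Proof.
by apply: (iffP exists_inP) => [[Q ? /andP[? ?]]|[Q [? ? ?]]]; exists Q => //; apply/andP.
Qed.

Lemma connect_adj1 F Q u v : Q \in F -> u \in Q -> v \in Q -> connect (adj F) u v.
Proof. by move=> ? ? ?; apply/connect1/adjP; exists Q. Qed.

Lemma adjS F F' : F' \subset F -> subrel (connect (adj F')) (connect (adj F)).
Proof.
move=> /subsetP sF; apply: connect_sub => u v /adjP[Q [QF uQ vQ]].
exact: (connect_adj1 (sF _ QF)).
Qed.

Lemma connect_ind (e : rel V) (A : V -> Prop) u v :
  A u -> (forall x y, connect e u x -> A x -> e x y -> A y) ->
  connect e u v -> A v.
Proof.
move=> Au step /connectP[p + ->]; elim/last_ind: p => //= p y IH.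
rewrite rcons_path last_rcons => /andP[ep ey]; apply: step ey; last exact: IH.
by apply/connectP; exists p.
Qed.

Lemma berge_sub F F' : F' \subset F -> berge F -> berge F'.
Proof.
move=> sF bF Q u v QF uQ vQ cuv; apply: (bF Q) => //; first exact: (subsetP sF).
by apply: adjS cuv; rewrite setSD.
Qed.

Lemma berge_meet F Q R u v : berge F -> Q \in F -> R \in F -> Q != R ->
  u \in Q -> v \in Q -> u \in R -> v \in R -> u = v.
Proof.
move=> bF QF RF nQR uQ vQ uR vR; apply: (bF Q) => //.
by apply: (@connect_adj1 _ R) => //; rewrite !inE eq_sym nQR.
Qed.

(** A branch is a member together with a vertex that it shares with another member. Take a branch
    [(Q, u)] with the fewest vertices reachable from [u] without [Q], and another member [R] at [u].
    Then [R] is a leaf attached at [u]: a second attachment vertex [u'] would give a branch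
    [(R, u')] reaching strictly less. *)
Lemma berge_leaf F : berge F -> set0 \notin F -> F != set0 ->
  exists Q t, [/\ Q \in F, t \in Q &
    forall R u, R \in F -> R != Q -> u \in Q -> u \in R -> u = t].
Proof.
move=> bF F0 /set0Pn[Q0 Q0F].
pose branch (q : {set V} * V) := [&& q.1 \in F, q.2 \in q.1 &
  [exists R in F, (R != q.1) && (q.2 \in R)]].
have [q0 bq0|nobr] := pickP branch; last first.
  have /set0Pn[t tQ0] : Q0 != set0 by apply: contraNneq F0 => <-.
  exists Q0, t; split=> // R u RF nRQ uQ uR; exfalso.
  move: (nobr (Q0, u)); rewrite /branch /= Q0F uQ /= => /exists_inP; apply.
  by exists R => //; rewrite nRQ.
pose reach (q : {set V} * V) := [set v | connect (adj (F :\ q.1)) q.2 v].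
case: (arg_minnP (fun q => #|reach q|) bq0) => -[Q u].
case/and3P=> /= QF uQ /exists_inP[R RF /andP[nRQ uR]] qmin.
exists R, u; split=> // R' u' R'F nR' u'R u'R'; apply/eqP/negPn/negP => nu.
have bR : branch (R, u').
  by rewrite /branch /= RF u'R; apply/exists_inP; exists R'; rewrite // nR'.
have := qmin _ bR; apply/negP; rewrite -ltnNge; apply: proper_card.
have uu' : connect (adj (F :\ Q)) u u'.
  by apply: (@connect_adj1 _ R) => //; rewrite !inE nRQ.
apply/properP; split; last first.
  exists u; rewrite !inE /= ?connect0 //; apply: contraNN nu => cu.
  by apply/eqP/(bF R).
apply/subsetP => v; rewrite !inE /=.
apply: (connect_ind (A := fun v => connect (adj (F :\ Q)) u v) uu') => x y cx ux /adjP[S [/setD1P[nS SF] xS yS]].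
have [SQ|nSQ] := eqVneq S Q; last first.
  by apply: connect_trans ux _; apply: (@connect_adj1 _ S) => //; rewrite !inE nSQ.
(* If the walk from [u'] used [Q], it would reach [u] without [R] and close a chain on [R]. *)
case/eqP: nu; apply: (bF R) => //; apply: connect_trans cx _.
by apply: (@connect_adj1 _ S) => //; rewrite ?inE ?nS // SQ.
Qed.

Definition hits Z F := forall Q, Q \in F -> Q :&: Z != set0.

Lemma meetI Q Z u : u \in Q -> u \in Z -> Q :&: Z != set0.
Proof. by move=> uQ uZ; apply/set0Pn; exists u; rewrite inE uQ. Qed.

Lemma packing_le M Z : trivIset M -> hits Z M -> #|M| <= #|Z|.
Proof.
move=> tM hZ; have [->|/set0Pn[Q0 Q0M]] := eqVneq M set0; first by rewrite cards0.
have /set0Pn[z0 _] := hZ _ Q0M.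
have f_ex Q : exists z, (Q \in M) ==> (z \in Q :&: Z).
  have [QM|_] := boolP (Q \in M); last by exists z0.
  by have /set0Pn[z ?] := hZ _ QM; exists z.
pose f Q := xchoose (f_ex Q).
have fP Q : Q \in M -> f Q \in Q :&: Z.
  exact: (implyP (xchooseP (f_ex Q))).
have finj : {in M &, injective f}.
  move=> Q R QM RM eqf; apply/eqP/negPn/negP => nQR.
  have /disjointFr := trivIsetP tM _ _ QM RM nQR.
  by move/(_ (f Q)) => E; case/setIP: (fP _ QM) (fP _ RM) => /E; rewrite eqf inE => ->.
rewrite -(card_in_imset finj); apply: subset_leq_card.
by apply/subsetP => _ /imsetP[Q QM ->]; case/setIP: (fP _ QM).
Qed.

(* Butterflies without a construction order; in a Berge-acyclic family an order
   of the kind required by [bforest] always exists, see [butterflies_bforest]. *)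
Definition butterflies X B :=
  (forall t, t \in X -> #|[set Q in B | t \in Q]| = 2) /\
  (forall Q, Q \in B -> #|Q :&: X| = 1).

(** Equality of [#|M|] and [#|X|] is carried along because it makes [X] minimum. The first
    alternative is inherited by adding [t] to [Z]; the second turns into the first when [X] already
    meets every member but [c]. *)
Lemma berge_dichotomy F : berge F -> set0 \notin F ->
  exists X M, [/\ hits X F, M \subset F, trivIset M, #|M| = #|X| &
    (exists c Z, #|Z| < #|X| /\ hits Z (F :\ c)) \/
    (exists B, B \subset F /\ butterflies X B)].
Proof.
elim: {F}_.+1 {-2}F (ltnSn #|F|) => // n IH F; rewrite ltnS => leF bF F0.
have [->|Fn0] := eqVneq F set0.
  exists set0, set0; split=> //; rewrite ?cards0 //.
  - by move=> Q; rewrite inE.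
  - by apply/trivIsetP => A B'; rewrite inE.
  by right; exists set0; split; rewrite ?sub0set //; split=> t; rewrite inE.
have [c [t [cF tc leaf]]] := berge_leaf bF F0 Fn0.
pose F' := [set Q in F | t \notin Q].
have sF : F' \subset F by apply/subsetP => Q; rewrite inE => /andP[].
have ltF : #|F'| < n.
  apply: leq_trans leF; apply: proper_card; apply/properP; split=> //.
  by exists c; rewrite // inE tc andbF.
have F'0 : set0 \notin F' by apply: contraNN F0 => /(subsetP sF).
have disj Q : Q \in F' -> [disjoint c & Q].
  rewrite inE => /andP[QF tQ]; apply/pred0P => u /=; apply/negP => /andP[uc uQ].
  have nQ : Q != c by apply: contraNneq tQ => ->.
  by case/negP: tQ; rewrite -(leaf Q u).
have [X [M [hX sM tM cM alt]]] := IH F' ltF (berge_sub sF bF) F'0.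
(* [G] is left free for two uses: all sets for [F] itself, and the complement of a member [d] for
   [F] without [d]. *)
have cut Z G : hits Z (F' :&: G) -> hits (t |: Z) (F :&: G).
  move=> hZ Q /setIP[QF QG]; have [tQ|tQ] := boolP (t \in Q).
    by apply: (@meetI _ _ t) => //; rewrite !inE eqxx.
  have /set0Pn[z /setIP[zQ zZ]] : Q :&: Z != set0.
    by apply: hZ; rewrite !inE QF tQ.
  by apply: (@meetI _ _ z) => //; rewrite !inE zZ orbT.
(* [c] misses every cycle of [F'], so a minimum hitting set [X] of [F'] avoids [c] *)
pose X0 := X :\: c.
have hX0 : hits X0 F'.
  move=> Q QF'; have /set0Pn[z /setIP[zQ zX]] := hX _ QF'.
  apply: (@meetI _ _ z) => //; rewrite !inE zX andbT.
  by rewrite (disjointFl (disj _ QF')).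
have sMF := subset_trans sM sF.
have MX0 : #|M| <= #|X0| by apply: packing_le tM _ => Q /(subsetP sM)/hX0.
have eqX : X0 = X.
  by apply/eqP; rewrite eqEcard subsetDl -cM.
have tX : t \notin X by rewrite -eqX !inE tc.
exists (t |: X), (c |: M).
have [tM' cM'] : trivIset (c |: M) /\ c \notin M.
  apply: trivIsetU1 => //; first by move=> Q /(subsetP sM)/disj.
  by apply: contraNN F0 => /(subsetP sMF).
split=> //.
- by rewrite -[F]setIT; apply: cut; rewrite setIT.
- by rewrite subUset sub1set cF.
- by rewrite !cardsU1 cM' tX cM.
have [[d [Z [ltZ hZ]]]|[B [sB [B1 B2]]]] := alt.
  left; exists d, (t |: Z); split.
    by rewrite !cardsU1 tX add1n ltnS; case: (_ \notin Z); rewrite ?add1n // ltnW.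
  by rewrite setDE; apply: cut; rewrite -setDE.
have [/exists_inP[P PF /andP[nPc PX]]|noP] :=
    boolP [exists P in F, (P != c) && [disjoint P & X]]; last first.
  left; exists c, X; split; first by rewrite cardsU1 tX.
  move=> Q /setD1P[nQ QF]; rewrite setI_eq0.
  by apply: contraNN noP => dQ; apply/exists_inP; exists Q; rewrite // nQ.
have tP : t \in P.
  apply: contraLR PX => tP; rewrite -setI_eq0; apply: hX.
  by rewrite inE PF.
have tB Q : Q \in B -> t \notin Q by move/(subsetP sB); rewrite inE => /andP[].
right; exists (c |: (P |: B)); split.
  by rewrite !subUset !sub1set cF PF (subset_trans sB).
split=> [u|Q].
  rewrite in_setU1 => /predU1P[->|uX].
    rewrite (_ : [set _ in _ | _] = [set c; P]) ?cards2 1?eq_sym ?nPc //.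
    apply/setP => Q; rewrite !inE; have [->|nQc] := eqVneq Q c => //=.
    have [->|nQP] := eqVneq Q P => //=.
    by apply/andP => -[/tB/negP].
  rewrite -(B1 u uX); congr #|pred_of_set _|; apply/setP => Q; rewrite !inE.
  have uc : u \notin c by move: uX; rewrite -eqX inE => /andP[].
  have uP : u \notin P by rewrite (disjointFl PX).
  have [->|nQc] := eqVneq Q c => //=; first by rewrite (negPf uc) andbF.
  by have [->|nQP] := eqVneq Q P => //=; rewrite (negPf uP) andbF.
rewrite !inE => /or3P[/eqP->|/eqP->|QB].
- rewrite setIUr (_ : c :&: X = set0); last first.
    by rewrite -eqX; apply/setP => z; rewrite !inE; case: (z \in c).
  rewrite setU0 (_ : _ :&: _ = [set t]) ?cards1 //.
  by apply/setIidPr; rewrite sub1set.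
- rewrite setIUr (_ : P :&: X = set0); last by apply/eqP; rewrite setI_eq0.
  rewrite setU0 (_ : _ :&: _ = [set t]) ?cards1 //.
  by apply/setIidPr; rewrite sub1set.
rewrite setIUr (_ : Q :&: [set t] = set0) ?set0U ?B2 //.
apply/setP => z; rewrite !inE; apply/andP => -[zQ /eqP zt].
by have := tB Q QB; rewrite -zt zQ.
Qed.

(* [c] and [P] are the two cycles of the new butterfly, [t] is its center and [P]
   may be glued at one noncentral vertex of what precedes. *)
Inductive bforest : nat -> {set {set V}} -> {set V} -> Prop :=
| bforest0 : bforest 0 set0 set0
| bforestS n B X c P t : bforest n B X -> c :&: P = [set t] -> c != P ->
    [disjoint c & cover B] -> #|P :&: cover B| <= 1 -> [disjoint P & X] ->
    bforest n.+1 (c |: (P |: B)) (t |: X).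

Lemma coverU1 c B : cover (c |: B) = c :|: cover B.
Proof.
apply/setP => u; rewrite inE; apply/bigcupP/orP => [[Q /setU1P[->|QB] uQ]|].
- by left.
- by right; apply/bigcupP; exists Q.
by case=> [uc|/bigcupP[Q QB uQ]]; [exists c|exists Q]; rewrite ?inE ?eqxx ?QB ?orbT.
Qed.

Lemma in_cover B Q u : Q \in B -> u \in Q -> u \in cover B.
Proof. by move=> ? ?; apply/bigcupP; exists Q. Qed.

(** The unions [D t] of the two cycles at a center form again a Berge-acyclic family. A leaf of that
    family is a butterfly meeting all others in at most one vertex [p], so it can be placed last in
    the order. *)
Lemma butterflies_bforest X B : berge B -> butterflies X B -> bforest #|X| B X.
Proof.
move cX: #|X| => n; elim: n X B cX => [|n IH] X B cX bB [B1 B2].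
  have X0 := cards0_eq cX; rewrite X0 (_ : B = set0); first exact: bforest0.
  by apply/setP => Q; rewrite inE; apply/negP => /B2; rewrite X0 setI0 cards0.
have uniqX Q t t' : Q \in B -> t \in X -> t' \in X -> t \in Q -> t' \in Q -> t = t'.
  move=> QB tX t'X tQ t'Q; have /eqP/cards1P[z Ez] := B2 Q QB.
  have := in_setI t Q X; rewrite Ez tX tQ => /set1P ->.
  by have := in_setI t' Q X; rewrite Ez t'X t'Q => /set1P ->.
pose D t := cover [set Q in B | t \in Q].
have DP t u : reflect (exists Q, [/\ Q \in B, t \in Q & u \in Q]) (u \in D t).
  apply: (iffP bigcupP) => [[Q]|[Q [QB tQ uQ]]].
    by rewrite inE => /andP[? ?] ?; exists Q.
  by exists Q; rewrite // inE QB.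
have tD t : t \in X -> t \in D t.
  move=> /B1 /eqP/cards2P[Q [R [_ E]]].
  have : Q \in [set Q; R] by rewrite !inE eqxx.
  by rewrite -E inE => /andP[QB tQ]; apply/DP; exists Q.
have Dinj t t' : t \in X -> t' \in X -> t \in D t' -> t = t'.
  by move=> tX t'X /DP[Q [QB t'Q tQ]]; apply: (uniqX Q).
have bD : berge [set D t | t in X].
  move=> _ u v /imsetP[t tX ->] /DP[Q [QB tQ uQ]] /DP[R [RB tR vR]] cuv.
  (* A link through [D t'] is replaced by two links of [B] that meet at [t']. They avoid [S] because
     the only center on [S] is [t]. *)
  have cB S : S \in B -> t \in S -> connect (adj (B :\ S)) u v.
    move=> SB tS; apply: connect_sub cuv => x y /adjP[S0 [/setD1P[nD /imsetP[t' t'X eS0]]]]; rewrite eS0 in nD *.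
    have nt : t' != t by apply: contraNneq nD => ->.
    have nS S' : S' \in B -> t' \in S' -> S' \in B :\ S.
      move=> S'B t'S'; rewrite !inE S'B andbT; apply: contraNneq nt => eS.
      by apply/eqP/(uniqX S') => //; rewrite eS.
    move=> /DP[S1 [S1B t1 xS1]] /DP[S2 [S2B t2 yS2]].
    apply: connect_trans (_ : connect _ t' _).
      by apply: (@connect_adj1 _ S1); rewrite ?nS.
    by apply: (@connect_adj1 _ S2); rewrite ?nS.
  have [eQR|nQR] := eqVneq Q R.
    by apply: (bB Q) => //; [rewrite eQR | apply: cB].
  have ut : u = t.
    apply: (bB Q) => //; apply: connect_trans (cB Q QB tQ) _.
    by apply: (@connect_adj1 _ R); rewrite // !inE eq_sym nQR.
  apply: (bB R) => //; first by rewrite ut.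
  exact: cB.
have X0 : X != set0 by rewrite -card_gt0 cX.
have D0 : set0 \notin [set D t | t in X].
  by apply/imsetP => -[t /tD + E]; rewrite -E inE.
have DX : [set D t | t in X] != set0.
  by have /set0Pn[t tX] := X0; apply/set0Pn; exists (D t); apply: imset_f.
have [_ [p [/imsetP[t tX ->] pD leaf]]] := berge_leaf bD D0 DX.
pose B' := [set Q in B | t \notin Q].
have sB : B' \subset B by apply/subsetP => Q; rewrite inE => /andP[].
have leafB Q R u : Q \in B -> t \in Q -> R \in B' -> u \in Q -> u \in R -> u = p.
  rewrite inE => QB tQ /andP[RB tR] uQ uR.
  have /eqP/cards1P[t' Et'] := B2 R RB.
  have /setIP[t'R t'X] : t' \in R :&: X by rewrite Et' set11.
  apply: (leaf (D t')); first exact: imset_f.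
  - apply: contraNneq tR => E; suff <- : t' = t by [].
    by apply: (Dinj t' t) => //; rewrite -E tD.
  - by apply/DP; exists Q.
  by apply/DP; exists R.
(* The two cycles at [t] are named so that [p] lies on [P]; this is what leaves [c] disjoint from
   the rest. *)
have [c [P [ncP Et pP]]] : exists c P, [/\ c != P, [set Q in B | t \in Q] = [set c; P] & p \in P].
  have /eqP/cards2P[c [P [ncP Et]]] := B1 t tX.
  have /bigcupP[Q] := pD; rewrite Et !inE => /orP[]/eqP-> pQ.
    by exists P, c; split; rewrite 1?eq_sym // setUC.
  by exists c, P.
have [cB tc] : c \in B /\ t \in c.
  by apply/andP; rewrite -(in_set (fun Q => (Q \in B) && (t \in Q))) Et set21.
have [PB tP] : P \in B /\ t \in P.
  by apply/andP; rewrite -(in_set (fun Q => (Q \in B) && (t \in Q))) Et set22.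
have EB : B = c |: (P |: B').
  apply/setP => Q; have := congr1 (fun A : {set _} => Q \in A) Et.
  rewrite /B' !inE; case: (Q =P c) => [->|_]; first by rewrite cB.
  by case: (Q =P P) => [->|_] /=; [rewrite PB | case: (Q \in B); case: (t \in Q)].
have EX : X = t |: X :\ t by rewrite setD1K.
rewrite [in X in bforest _ X]EB [in X in bforest _ _ X]EX.
apply: bforestS => //.
- apply: IH; first by apply/eqP; rewrite -eqSS -cX (cardsD1 t X) tX.
  + exact: berge_sub bB.
  split=> [u /setD1P[nu uX]|Q].
    rewrite -(B1 u uX); congr #|pred_of_set _|; apply/setP => Q; rewrite !inE -andbA.
    have [QB|//] := boolP (Q \in B); have [uQ|] := boolP (u \in Q); last by rewrite andbF.
    rewrite andbT /=; apply: contraNN nu => tQ.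
    by apply/eqP; apply: (uniqX Q).
  rewrite inE => /andP[QB tQ]; rewrite -(B2 Q QB); congr #|pred_of_set _|.
  apply/setP => u; rewrite !inE; have [uQ|//] := boolP (u \in Q).
  by rewrite (_ : u != t) //; apply: contraNneq tQ => <-.
- apply/eqP; rewrite eqEsubset sub1set inE tc tP !andbT; apply/subsetP => u /setIP[uc uP].
  by rewrite inE; apply/eqP; apply: (berge_meet bB cB PB).
- apply/pred0P => u /=; apply/negP => /andP[uc /bigcupP[Q QB' uQ]].
  have up : u = p by apply: (leafB c Q).
  have ut : u = t by apply: (berge_meet bB cB PB) => //; rewrite up.
  by move: QB'; rewrite inE -ut uQ andbF.
- rewrite -(cards1 p); apply: subset_leq_card; apply/subsetP => u /setIP[uP /bigcupP[Q QB' uQ]].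
  by rewrite inE; apply/eqP/(leafB P Q).
apply/pred0P => u /=; apply/negP => /andP[uP /setD1P[nu uX]].
by case/eqP: nu; apply: (uniqX P).
Qed.

Lemma bforest_sub_cover n B X : bforest n B X -> X \subset cover B.
Proof.
elim=> [|m C Y c P t _ IH cP _ _ _ _]; first exact: sub0set.
rewrite !coverU1 subUset sub1set !inE.
have /setIP[-> _] : t \in c :&: P by rewrite cP set11.
by rewrite (subset_trans IH) // setUA subsetUr.
Qed.

Lemma bforest_center n B X : bforest n B X -> forall Q, Q \in B -> #|Q :&: X| <= 1.
Proof.
elim=> [|m C Y c P t /bforest_sub_cover YC IH cP ncP dc _ dP] Q; first by rewrite inE.
have tc : t \in c by have /setIP[] : t \in c :&: P by rewrite cP set11.
rewrite !inE setIUr => /or3P[/eqP->|/eqP->|QC].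
- rewrite (_ : c :&: Y = set0) ?setU0; last first.
    by apply/eqP; rewrite setI_eq0 disjoint_sym (disjointWl YC) // disjoint_sym.
  by rewrite -(cards1 t) subset_leq_card ?subsetIr.
- rewrite (_ : P :&: Y = set0) ?setU0; last by apply/eqP; rewrite setI_eq0.
  by rewrite -(cards1 t) subset_leq_card ?subsetIr.
rewrite (_ : Q :&: [set t] = set0) ?set0U ?IH //.
apply/eqP; rewrite setI_eq0 disjoint_sym disjoints1.
by apply: contraFN (disjointFr dc tc) => /(in_cover QC).
Qed.

Lemma bforest_card n B X : bforest n B X -> #|X| = n.
Proof.
elim=> [|m C Y c P t bC IH cP _ dc _ _]; first by rewrite cards0.
have tc : t \in c by have /setIP[] : t \in c :&: P by rewrite cP set11.
rewrite cardsU1 IH (_ : t \notin Y) //.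
by apply: contraFN (disjointFr dc tc); apply/subsetP; apply: bforest_sub_cover bC.
Qed.

(** The two parts need a joint induction. If [Z] has at most [m] elements, misses [c] and hits all
    older members, the first part for the older forest forces [Z = Y], and then [P] is missed as
    well as [c]. With [n = k.+1] the second part says that [k] deletions leave two cycles. *)
Lemma bforest_hits n B X : bforest n B X ->
  (forall Z, #|Z| <= n -> hits Z B -> Z = X) /\
  (forall Z, #|Z| < n -> exists Q R, [/\ Q \in B, R \in B, Q != R,
     [disjoint Q & Z] & [disjoint R & Z]]).
Proof.
elim=> [|m C Y c P t bC [IH1 IH2] cP ncP dc _ dP].
  by split=> // Z; rewrite leqn0 cards_eq0 => /eqP.
have [tc tP] : t \in c /\ t \in P by apply/setIP; rewrite cP set11.
have split_card Z : #|Z| = #|c :&: Z| + #|Z :\: c|.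
  by rewrite setIC cardsID.
have out Z Q : Q \in C -> Q :&: (Z :\: c) = Q :&: Z.
  move=> QC; apply/setP => u; rewrite !inE; have [uQ|//] := boolP (u \in Q).
  by rewrite (disjointFl dc (in_cover QC uQ)).
split=> Z.
  move=> leZ hZ; have hc : 0 < #|c :&: Z|.
    by rewrite card_gt0 hZ // !inE eqxx.
  have EY : Z :\: c = Y.
    apply: IH1; first by rewrite -ltnS (leq_trans _ leZ) // (split_card Z) -add1n leq_add2r.
    by move=> Q QC; rewrite out ?hZ // !inE QC !orbT.
  have /set0Pn[u /setIP[uP uZ]] : P :&: Z != set0 by rewrite hZ // !inE eqxx orbT.
  have uc : u \in c.
    apply: contraFT (disjointFr dP uP) => uc.
    by rewrite -EY inE uc.
  have ut : u = t by apply/set1P; rewrite -cP inE uc.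
  apply/esym/eqP; rewrite eqEcard -EY; apply/andP; split.
    by rewrite subUset sub1set -ut uZ subsetDl.
  rewrite EY cardsU1 (bforest_card bC) (_ : t \notin Y) ?add1n //.
  by rewrite (disjointFr dP tP).
move=> ltZ; have [/eqP hc|hc] := boolP (c :&: Z == set0); last first.
  have ltZc : #|Z :\: c| < m.
    by rewrite -ltnS (leq_trans _ ltZ) // ltnS (split_card Z) -add1n leq_add2r card_gt0.
  have [Q [R [QC RC nQR dQ dR]]] := IH2 _ ltZc.
  rewrite -setI_eq0 out // setI_eq0 in dQ; rewrite -setI_eq0 out // setI_eq0 in dR.
  by exists Q, R; rewrite !inE QC RC !orbT.
have [/exists_inP[Q QC dQ]|none] := boolP [exists Q in C, [disjoint Q & Z]].
  exists c, Q; rewrite !inE eqxx QC !orbT; split=> //; last by rewrite -setI_eq0 hc.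
  by apply: contraFneq (disjointFr dc tc) => cQ; apply: (in_cover QC); rewrite -cQ.
have EZ : Z = Y.
  apply: IH1 => // Q QC; apply: contraNneq none => dQ.
  by apply/exists_inP; exists Q; rewrite // -setI_eq0 dQ.
by exists c, P; rewrite !inE !eqxx orbT EZ dP -setI_eq0 -EZ hc.
Qed.

Lemma packing_hits M Z : trivIset M -> #|Z|.+1 < #|M| ->
  exists Q R, [/\ Q \in M, R \in M, Q != R, [disjoint Q & Z] & [disjoint R & Z]].
Proof.
move=> tM ltM; pose N := [set Q in M | [disjoint Q & Z]].
suff : 1 < #|N|.
  case/card_gt1P => Q [R [+ + nQR]]; rewrite !inE => /andP[QM dQ] /andP[RM dR].
  by exists Q, R.
suff : #|M :\: N| <= #|Z|.
  move=> le; rewrite -(ltn_add2l #|Z|) addn1 (leq_trans ltM) //.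
  rewrite -(cardsID N M) addnC leq_add // subset_leq_card //.
  by rewrite subsetIr.
apply: packing_le; first exact: trivIsetS (subsetDl _ _) tM.
by move=> Q; rewrite !inE setI_eq0 => /andP[+ QM]; rewrite QM.
Qed.

End Hypergraph.

(** * Images of butterfly forests under contractions *)

Section Transfer.
Variables (V W : finType) (pi : V -> W).
Implicit Types (B M : {set {set V}}) (Q c P X : {set V}).

Definition imfam B : {set {set W}} := [set pi @: Q | Q : {set V} in B].

(* [pi] only identifies noncentral vertices lying on a common cycle. This is the
   condition under which butterfly forests are preserved, and it is inherited by
   subforests. *)
Definition collapses B X := forall u v, u \in cover B -> v \in cover B ->
  pi u = pi v -> u = v \/
  exists2 Q, Q \in B & [/\ u \in Q, v \in Q, u \notin X & v \notin X].

Lemma cover_imfam B : cover (imfam B) = pi @: cover B.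
Proof.
apply/setP => w; apply/bigcupP/imsetP => [[_ /imsetP[Q QB ->] /imsetP[u uQ ->]]|].
  by exists u => //; apply: in_cover uQ.
case=> u /bigcupP[Q QB uQ] ->; exists (pi @: Q); exact: imset_f.
Qed.

(** Identifying noncentral vertices within one cycle creates no new intersection: a common image
    vertex of [c] and [P] comes from [t] alone, and [P] still shares at most one image vertex with
    the older part. *)
Lemma bforest_imfam n B X : bforest n B X -> collapses B X ->
  (forall Q, Q \in B -> 1 < #|pi @: Q|) -> bforest n (imfam B) (pi @: X).
Proof.
elim=> [|m C Y c P t bC IH cP ncP dc leP dP] col gt1.
  by rewrite /imfam !imset0; apply: bforest0.
have YC := bforest_sub_cover bC.
have [tc tP] : t \in c /\ t \in P by apply/setIP; rewrite cP set11.
set B' := c |: (P |: C) in col gt1.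
have cB : c \in B' by rewrite !inE eqxx.
have PB : P \in B' by rewrite !inE eqxx orbT.
have CB Q : Q \in C -> Q \in B' by move=> QC; rewrite !inE QC !orbT.
have cC u : u \in c -> u \in cover C -> False by move=> /(disjointFr dc) ->.
have PC u v : u \in P -> u \in cover C -> v \in P -> v \in cover C -> u = v.
  move=> uP uC vP vC; have /card_le1P/(_ u) := leP; rewrite inE uP uC => /(_ isT).
  by move=> /(_ v); rewrite !inE vP vC => /esym/eqP.
have covC u : u \in cover C -> u \in cover B'.
  by move=> /bigcupP[Q QC uQ]; apply: (in_cover (CB _ QC)).
have covc u : u \in c -> u \in cover B' by apply: in_cover.
have covP u : u \in P -> u \in cover B' by apply: in_cover.
have colc u v : u \in c -> v \in cover B' -> pi u = pi v -> u = v \/ v \in c /\ v != t.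
  move=> uc vB /col[||->|[Q]]; auto.
  rewrite !inE => /or3P[/eqP->|/eqP->|QC] [uQ vQ]; rewrite !negb_or => /andP[nu _] /andP[nv _].
  - by right.
  - by case/eqP: nu; apply/set1P; rewrite -cP inE uc.
  - by case: (cC u) => //; apply: in_cover uQ.
have colP u v : u \in P -> v \in cover C -> pi u = pi v ->
    v \notin Y /\ (u \in cover C \/ v \in P).
  move=> uP vC /col[||uv|[Q]]; auto.
    by rewrite -uv; split; [rewrite (disjointFr dP uP) | right].
  rewrite !inE => /or3P[/eqP->|/eqP->|QC] [uQ vQ _]; rewrite negb_or => /andP[_ nv].
  - by case: (cC v).
  - by split; last right.
  - by split; last by left; apply: in_cover uQ.
have colcP u v : u \in c -> v \in P -> pi u = pi v -> v = t.
  move=> uc vP /colc[||uv|[vc _]]; auto.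
    by apply/set1P; rewrite -cP inE -{1}uv uc.
  by apply/set1P; rewrite -cP inE vc.
rewrite /imfam !imsetU1 -/(imfam C); apply: bforestS.
(* [collapses] passes to [C]: two vertices of [cover C] identified through [P] both lie in
   [P :&: cover C] and so coincide, while [c] does not meet [cover C]. *)
- apply: IH => [u v uC vC /col[||->|[Q]]|Q QC]; auto.
  rewrite !inE => /or3P[/eqP->|/eqP->|QC] [uQ vQ]; rewrite !negb_or => /andP[_ nu] /andP[_ nv].
  + by case: (cC u).
  + by left; apply: PC.
  by right; exists Q.
- apply/setP => w; rewrite !inE; apply/andP/eqP => [[/imsetP[u uc ->] /imsetP[v vP uv]]|->].
    by rewrite uv (colcP u v).
  by rewrite !imset_f.
(* If [c] and [P] had the same image, it would be reduced to the image of [t]. *)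
- apply/eqP => E; have /card_gt1P[x [y [xc yc]]] := gt1 _ cB.
  have eqt z : z \in pi @: c -> z = pi t.
    move=> zc; have /imsetP[u uc zu] := zc.
    by move: zc; rewrite E zu => /imsetP[v vP uv]; rewrite uv (colcP u v).
  by rewrite (eqt x xc) (eqt y yc) eqxx.
- rewrite cover_imfam; apply/pred0P => w /=; apply/negP => /andP[/imsetP[u uc ->]].
  case/imsetP=> v vC /colc[||uv|[vc _]]; auto; last exact: (cC v).
  by apply: (cC u) => //; rewrite uv.
- rewrite cover_imfam; apply: leq_trans leP; apply: leq_trans (leq_imset_card pi _).
  apply: subset_leq_card; apply/subsetP => w /setIP[/imsetP[u uP ->] /imsetP[v vC uv]].
  have [_ [uC|vP]] := colP u v uP vC uv; first by rewrite imset_f // inE uP.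
  by rewrite uv imset_f // inE vP.
apply/pred0P => w /=; apply/negP => /andP[/imsetP[u uP ->] /imsetP[v vY uv]].
have vC := subsetP YC _ vY.
by have [] := colP u v uP vC uv; rewrite vY.
Qed.

Lemma packing_imfam M : trivIset M -> collapses M set0 ->
  (forall Q, Q \in M -> 0 < #|pi @: Q|) ->
  trivIset (imfam M) /\ #|imfam M| = #|M|.
Proof.
move=> tM col gt0.
have key Q R w : Q \in M -> R \in M -> w \in pi @: Q -> w \in pi @: R -> Q = R.
  move=> QM RM /imsetP[u uQ ->] /imsetP[v vR uv]; apply/eqP/negPn/negP => nQR.
  have dis S S' x : S \in M -> S' \in M -> x \in S -> x \in S' -> S = S'.
    move=> SM S'M xS xS'; apply/eqP/negPn/negP => nS.
    by have /disjointFr := trivIsetP tM _ _ SM S'M nS; move/(_ x xS); rewrite xS'.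
  case/eqP: nQR; have [||e|[S SM [uS vS _ _]]] := col u v _ _ uv.
  - exact: in_cover uQ.
  - exact: in_cover vR.
  - by apply: (dis _ _ u) => //; rewrite e.
  by rewrite (dis Q S u) // (dis S R v).
split.
  apply/trivIsetP => _ _ /imsetP[Q QM ->] /imsetP[R RM ->] nQR.
  apply/pred0P => w /=; apply/negP => /andP[wQ wR].
  by case/eqP: nQR; rewrite (key Q R w).
apply: card_in_imset => Q R QM RM eQR.
have /card_gt0P[w wQ] := gt0 _ QM.
by apply: (key Q R w); rewrite // -eQR.
Qed.

End Transfer.

(** * Butterfly forests made of triangles *)

Definition butterfly_center : butterfly := inl ord0.

Lemma card_butterfly : #|butterfly| = 5.
Proof. by rewrite card_sum card_sig card_ord cardC1 card_ord. Qed.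

Lemma degree_butterfly (v : butterfly) :
  degree v = if v == butterfly_center then 4 else 2.
Proof.
rewrite /degree; case: v => [i|w].
  have [/eqP|ni] := eqVneq (inl i : butterfly) butterfly_center.
    move=> /eqP[->].
    rewrite (_ : [set _ | _] = [set~ butterfly_center]) ?cardsC1 ?card_butterfly //.
    by apply/setP => -[j|[j nj]]; rewrite !inE //= /complete_edge eq_sym.
  rewrite (_ : [set _ | _] = inl @: [set~ i]).
    by rewrite card_imset ?cardsC1 ?card_ord // => x y [].
  apply/setP => -[j|j]; rewrite !inE /=.
    rewrite mem_imset ?inE 1?eq_sym // => x y []; done.
  rewrite [i == _](negPf _) /=; last by apply: contraNneq ni => ->.
  by symmetry; apply/imsetP => -[].
(* [phi] embeds the second triangle; its vertex [ord0] is the glued one, hence the default value. *)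
pose phi (j : 'I_3) : butterfly := if insub j is Some w then inr w else inl ord0.
have phi0 : phi ord0 = inl ord0 by rewrite /phi insubF.
have phir (w' : {w : 'I_3 | w != ord0}) : phi (val w') = inr w' by rewrite /phi valK.
have phiI : injective phi.
  move=> i j; rewrite /phi; case: insubP => [a _ <-|]; case: insubP => [b _ <-|] //.
    by move=> [->].
  by rewrite !negbK => /eqP-> /eqP->.
rewrite (_ : [set _ | _] = phi @: [set~ val w]).
  by rewrite card_imset ?cardsC1 ?card_ord.
apply/setP => -[j|j]; rewrite !inE /=.
  have e0 : complete_edge ord0 (val w) by rewrite /complete_edge eq_sym (valP w).
  rewrite e0 andbT; apply/eqP/imsetP => [->|[i]].
    by exists ord0; rewrite ?phi0 // !inE eq_sym (valP w).
  by rewrite /phi; case: insubP => // _ _ [->].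
by rewrite -phir mem_imset // !inE eq_sym.
Qed.

Lemma butterfly_centralE : butterfly_central = [set butterfly_center].
Proof. by apply/setP => v; rewrite !inE degree_butterfly; case: (v == _). Qed.

Lemma butterfly_extremalE : butterfly_extremal = [set~ butterfly_center].
Proof. by apply/setP => v; rewrite !inE degree_butterfly; case: (v == _). Qed.

(** The enumeration starts at [t] because the triangles of [butterfly] are glued at [ord0], which
    must be sent to the common vertex of the two cycles. *)
Lemma enum_card (V : finType) (A : {set V}) (t : V) : t \in A ->
  exists g : 'I_#|A| -> V, [/\ injective g, forall v, v \in A <-> exists i, g i = v &
    forall i, val i = 0 -> g i = t].
Proof.
move=> tA; pose s := t :: enum (A :\ t).
have us : uniq s by rewrite /= mem_enum !inE eqxx enum_uniq.
have sz : size s = #|A| by rewrite /= -cardE (cardsD1 t A) tA.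
have ms v : (v \in s) = (v \in A).
  by rewrite inE mem_enum !inE; case: eqP => // ->.
exists (fun i : 'I_#|A| => nth t s i); split=> [i j /eqP|v|i ->] //.
  by rewrite nth_uniq ?sz // => /eqP/val_inj.
rewrite -ms; split=> [vs|[i <-]]; last by rewrite mem_nth ?sz.
have lt : index v s < #|A| by rewrite -sz index_mem.
by exists (Ordinal lt); rewrite /= nth_index.
Qed.

Section Pieces.
Variable V : finType.
Implicit Types (B : {set {set V}}) (c P X D : {set V}).

Lemma butterfly_copy c P t : #|c| = 3 -> #|P| = 3 -> c :&: P = [set t] ->
  exists h : butterfly -> V, [/\ injective h,
    forall v, v \in c :|: P <-> exists a, h a = v,
    forall a, (h a == t) = (a == butterfly_center) &
    forall a b, edge a b = (a != b) &&
      ((h a \in c) && (h b \in c) || (h a \in P) && (h b \in P))].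
Proof.
move=> c3 P3 cP; have [tc tP] : t \in c /\ t \in P by apply/setIP; rewrite cP set11.
have := enum_card tP; have := enum_card tc; rewrite c3 P3.
move=> [g1 [g1I g1c g10]] [g2 [g2I g2P g20]].
have {}g10 := g10 ord0 erefl; have {}g20 := g20 ord0 erefl.
have c1 i : g1 i \in c by apply/g1c; exists i.
have P2 i : g2 i \in P by apply/g2P; exists i.
have P1 i : (g1 i \in P) = (i == ord0).
  apply/idP/eqP => [iP|->]; last by rewrite g10.
  by apply: g1I; rewrite g10; apply/set1P; rewrite -cP inE c1.
have c2 i : (g2 i \in c) = (i == ord0).
  apply/idP/eqP => [ic|->]; last by rewrite g20.
  by apply: g2I; rewrite g20; apply/set1P; rewrite -cP inE P2 andbT.
pose h (a : butterfly) := match a with inl i => g1 i | inr w => g2 (val w) end.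
have hI : injective h.
  move=> [i|w] [j|w'] /= E.
  - by rewrite (g1I _ _ E).
  - by have := c1 i; rewrite E c2 (negPf (valP w')).
  - by have := c1 j; rewrite -E c2 (negPf (valP w)).
  by rewrite (val_inj (g2I _ _ E)).
exists h; split=> //.
- move=> v; split=> [/setUP[/g1c[i <-]|/g2P[i <-]]|[[i|w] <-]] /=.
  + by exists (inl i).
  + have [->|ni] := eqVneq i ord0; first by exists (inl ord0); rewrite /= g10 g20.
    by exists (inr (Sub i ni)).
  + by rewrite inE c1.
  by rewrite inE P2 orbT.
- by move=> a; rewrite -g10 -[g1 ord0]/(h (inl ord0)) (inj_eq hI).
have e0 (w : {w : 'I_3 | w != ord0}) : complete_edge ord0 (val w).
  by rewrite /complete_edge eq_sym (valP w).
move=> [i|w] [j|w'] /=.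
- by rewrite !c1 (inj_eq inl_inj) /= andbT.
- by rewrite c1 P2 c2 P1 /= (negPf (valP w')) e0.
- by rewrite c1 P2 c2 P1 /= (negPf (valP w)) e0 andbT.
by rewrite !P2 orbT (inj_eq inr_inj) /= andbT.
Qed.

(** Edges are read off from [adj B] through an embedding [g], since the ambient vertex set stays
    fixed while [B] grows. Centers are matched with [X] because the next butterfly must be glued at
    a noncentral vertex. *)
Definition zpiece B X D := exists (H : sgraph) (C : {set H}) (g : H -> V),
  [/\ @butterfly_tree #|X :&: D| H C, injective g,
      forall v, v \in D <-> exists a, g a = v,
      forall a, (g a \in X) = (a \in C) &
      forall a b, edge a b = (a != b) && adj B (g a) (g b)].

Lemma adjU1 c B u v : adj (c |: B) u v = (u \in c) && (v \in c) || adj B u v.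
Proof.
apply/adjP/orP => [[Q [/setU1P[->|QB] uQ vQ]]|[/andP[uc vc]|/adjP[Q [QB uQ vQ]]]].
- by left; rewrite uQ.
- by right; apply/adjP; exists Q.
- by exists c; rewrite !inE eqxx.
by exists Q; rewrite !inE QB orbT.
Qed.

Lemma adj_cover B u v : adj B u v -> u \in cover B /\ v \in cover B.
Proof. by case/adjP=> Q [QB uQ vQ]; split; apply: in_cover QB _. Qed.

Lemma trivIset_setU1 D B : (forall Q, Q \in B -> [disjoint D & Q]) ->
  trivIset B -> trivIset (D |: B).
Proof.
move=> dD tB; apply/trivIsetP => Q R /setU1P[->|QB] /setU1P[->|RB] nQR.
- by rewrite eqxx in nQR.
- exact: dD.
- by rewrite disjoint_sym; apply: dD.
exact: (trivIsetP tB).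
Qed.

(** The members of [Ds] are the future connected components. A new butterfly either starts a piece
    or is merged into the one piece containing the single vertex where [P] meets the older part. *)
Lemma bforest_pieces n B X : bforest n B X -> (forall Q, Q \in B -> #|Q| = 3) ->
  exists Ds : {set {set V}}, [/\ trivIset Ds, cover Ds = cover B,
    forall Q, Q \in B -> exists2 D, D \in Ds & Q \subset D &
    forall D, D \in Ds -> zpiece B X D].
Proof.
elim=> [|m C Y c P t bC IH cP ncP dc leP dP] card3.
  exists set0; split; rewrite ?/cover ?big_set0 //.
  - by apply/trivIsetP => A ?; rewrite inE.
  - by move=> Q; rewrite inE.
  by move=> D; rewrite inE.
have [|Ds [tDs cDs subD zD]] := IH; first by move=> Q QC; rewrite card3 // !inE QC !orbT.
have c3 : #|c| = 3 by rewrite card3 // !inE eqxx.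
have P3 : #|P| = 3 by rewrite card3 // !inE eqxx orbT.
have [h [hI hcP ht hedge]] := butterfly_copy c3 P3 cP.
have [tc tP] : t \in c /\ t \in P by apply/setIP; rewrite cP set11.
have YC := bforest_sub_cover bC.
have cC u : u \in c -> u \in cover C = false by move/(disjointFr dc).
have PC u v : u \in P -> u \in cover C -> v \in P -> v \in cover C -> u = v.
  move=> uP uC vP vC; have /card_le1P/(_ u) := leP; rewrite inE uP uC => /(_ isT).
  by move=> /(_ v); rewrite !inE vP vC => /esym/eqP.
(* Two distinct old vertices never lie together on [c] or on [P], so older pieces keep exactly their
   edges. *)
have adj_old u v : u \in cover C -> v \in cover C -> u != v ->
    adj (c |: (P |: C)) u v = adj C u v.
  move=> uC vC nuv; rewrite !adjU1; have [/cC|_ /=] := boolP (u \in c); first by rewrite uC.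
  case: andP => // -[uP vP]; case/eqP: nuv; exact: PC.
have adj_new a b : ~~ adj C (h a) (h b) ->
    edge a b = (a != b) && adj (c |: (P |: C)) (h a) (h b).
  by move=> nadj; rewrite hedge !adjU1 (negPf nadj) orbF.
have cYP u : u \in c :|: P -> u \notin Y.
  case/setUP=> [uc|/(disjointFr dP)->//].
  by apply: contraFN (cC u uc); apply/subsetP.
have old D : D \in Ds -> zpiece (c |: (P |: C)) (t |: Y) D.
  move=> DDs; have [H [K [g [bt gI gD gY ge]]]] := zD D DDs.
  have gC a : g a \in cover C by rewrite -cDs; apply: in_cover DDs _; apply/gD; exists a.
  have tD : t \notin D.
    by apply: contraFN (cC t tc); rewrite -cDs; apply: in_cover.
  exists H, K, g; split=> //.
  - rewrite setIUl (_ : [set t] :&: D = set0) ?set0U //.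
    by apply/eqP; rewrite setI_eq0 disjoints1.
  - move=> a; rewrite !inE gY (_ : g a == t = false) //.
    by apply: contraFF (cC t tc) => /eqP<-.
  move=> a b; rewrite ge; have [//|nab] := eqVneq a b.
  by rewrite adj_old ?gC ?(inj_eq gI).
have hin a : h a \in c :|: P by apply/hcP; exists a.
have hX a : (h a \in t |: Y) = (a == butterfly_center).
  by rewrite in_setU1 ht (negPf (cYP _ (hin a))) orbF.
have [PC0|] := eqVneq (P :&: cover C) set0.
  have hC a : h a \notin cover C.
    apply/negP => haC; case/setUP: (hin a) => [/cC|haP]; first by rewrite haC.
    by have := in_set0 (h a); rewrite -PC0 inE haP haC.
  exists ((c :|: P) |: Ds); split.
  - apply: trivIset_setU1 => // D DDs; apply/pred0P => u /=; apply/negP => /andP[/hcP[a <-] uD].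
    by case/negP: (hC a); rewrite -cDs; apply: in_cover uD.
  - by rewrite !coverU1 cDs setUA.
  - move=> Q; rewrite !inE => /or3P[/eqP->|/eqP->|/subD[D DDs QD]].
    + by exists (c :|: P); rewrite ?subsetUl ?setU11.
    + by exists (c :|: P); rewrite ?subsetUr ?setU11.
    by exists D; rewrite // inE DDs orbT.
  move=> D /setU1P[->|]; last exact: old.
  exists butterfly, butterfly_central, h; split=> //.
  - rewrite (_ : _ :&: _ = [set t]) ?cards1; first exact: butterfly_tree1.
    apply/setP => u; rewrite !in_setI !inE; have [->|nu] := eqVneq u t; first by rewrite tc.
    by apply/negP => /andP[/= uY]; rewrite -in_setU => /cYP; rewrite uY.
  - by move=> a; rewrite hX butterfly_centralE inE.
  move=> a b; apply: adj_new; apply: contraNN (hC a).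
  by case/adj_cover.
case/set0Pn=> p /setIP[pP pC].
have Pp u : u \in P -> u \in cover C -> u = p by move=> uP uC; apply: PC.
have [D DDs pD] : exists2 D, D \in Ds & p \in D by apply/bigcupP; rewrite -/(cover Ds) cDs.
have DC u : u \in D -> u \in cover C by rewrite -cDs; apply: in_cover.
have covDs : cover Ds = D :|: cover (Ds :\ D) by rewrite -coverU1 setD1K.
exists ((D :|: (c :|: P)) |: (Ds :\ D)); split.
- apply: trivIset_setU1 => [E /setD1P[nE EDs]|]; last exact: trivIsetS (subsetDl _ _) tDs.
  have dDE := trivIsetP tDs _ _ EDs DDs nE.
  apply/pred0P => u /=; apply/negP => /andP[+ uE].
  have uC : u \in cover C by rewrite -cDs; apply: in_cover uE.
  case/setUP=> [uD|/setUP[/cC|uP]]; first by rewrite (disjointFr dDE uE) in uD.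
    by rewrite uC.
  by rewrite -(Pp u uP uC) (disjointFr dDE uE) in pD.
- by rewrite !coverU1 -cDs covDs !setUA; congr (_ :|: _); rewrite -setUA setUC.
- move=> Q; rewrite !inE => /or3P[/eqP->|/eqP->|/subD[E EDs QE]].
  + by exists (D :|: (c :|: P)); rewrite ?setU11 // setUCA subsetUl.
  + by exists (D :|: (c :|: P)); rewrite ?setU11 // setUA subsetUr.
  have [eED|nED] := eqVneq E D; last by exists E; rewrite // !inE nED EDs orbT.
  by exists (D :|: (c :|: P)); rewrite ?setU11 // (subset_trans QE) // eED subsetUl.
move=> E /setU1P[->|/setD1P[_ ]]; last exact: old.
have [H [K [g [bt gI gD gY ge]]]] := zD D DDs.
(* [v] and [z] are the two names of the attachment vertex [p], in the old piece and in the new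
   butterfly. [z] is extremal because [p] lies in [cover C] and [t] does not. *)
have [v gv] : exists v, g v = p by apply/gD.
have [z hz] : exists z, h z = p by apply/hcP; rewrite inE pP orbT.
have pt : p != t by apply: contraTneq pC => ->; rewrite cC.
have zc : z != butterfly_center by rewrite -ht hz.
have vK : v \notin K by rewrite -gY gv cYP // inE pP orbT.
have zext : z \in butterfly_extremal by rewrite butterfly_extremalE !inE.
have gC a : g a \in cover C by apply: DC; apply/gD; exists a.
have hC a : h a \in cover C -> a = z.
  move=> haC; apply: hI; rewrite hz; case/setUP: (hin a) => [/cC|haP]; first by rewrite haC.
  exact: Pp.
pose g' (a : identify v z) := match a with inl u => g u | inr w => h (val w) end.
have := butterfly_treeS bt vK zext; set K' := [set _ | _] => bt'.
exists (identify v z), K', g'; split.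
- suff -> : #|(t |: Y) :&: (D :|: (c :|: P))| = #|Y :&: D|.+1 by [].
  have tD : t \notin Y :&: D by apply/negP => /setIP[_ /DC]; rewrite cC.
  have := cardsU1 t (Y :&: D); rewrite tD add1n => <-.
  congr #|pred_of_set _|; apply/setP => u; rewrite !in_setI !in_setU1 (in_setU u D) !in_setI.
  have [->|nu] := eqVneq u t; first by rewrite inE tc orbT.
  have [uY|//] := boolP (u \in Y); rewrite /=.
  by have [/cYP|] := boolP (u \in c :|: P); rewrite ?uY // orbF.
- have gh u (w : {w : butterfly | w != z}) : g u <> h (val w).
    by move=> E'; have := valP w; rewrite /= (hC (val w)) ?eqxx // -E'.
  move=> [u|w] [u'|w'] /= E'.
  + by rewrite (gI _ _ E').
  + by case: (gh _ _ E').
  + by case: (gh _ _ (esym E')).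
  by rewrite (val_inj (hI _ _ E')).
- move=> u; split=> [/setUP[/gD[a <-]|/hcP[a <-]]|[[a|w] <-]] /=.
  + by exists (inl a).
  + have [->|na] := eqVneq a z; first by exists (inl v); rewrite /= gv hz.
    by exists (inr (Sub a na)).
  + by rewrite inE; apply/orP; left; apply/gD; exists a.
  by rewrite inE hin orbT.
- move=> [u|w]; rewrite !inE /=.
    rewrite -gY (_ : g u == t = false) //.
    by apply: contraFF (cC t tc) => /eqP<-.
  by rewrite degree_butterfly -in_setU1 hX; case: (_ == _).
have hnC (w : {w : butterfly | w != z}) : h (val w) \notin cover C.
  by apply/negP => /hC E'; have := valP w; rewrite E' eqxx.
have gc u : g u \in c = false by apply/negP => /cC; rewrite gC.
(* An old and a new vertex can share only the member [P], and only if the old one is [p]; this is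
   the mixed case of [identify_edge]. *)
have mix u (w : {w : butterfly | w != z}) :
    (u == v) && edge z (val w) = adj (c |: (P |: C)) (g u) (h (val w)).
  rewrite hedge hz !adjU1 gc (_ : adj C _ _ = false) ?orbF; last first.
    by apply: contraNF (hnC w) => /adj_cover[].
  rewrite (_ : p \in c = false); last by apply/negP => /cC; rewrite pC.
  have nz : z != val w by rewrite eq_sym (valP w).
  rewrite pP nz /=; congr (_ && _).
  apply/eqP/idP => [->|guP]; first by rewrite gv.
  by apply: gI; rewrite gv; apply: Pp.
have nlr u w : (inl u != inr w :> identify v z) by [].
have nrl u w : (inr w != inl u :> identify v z) by [].
move=> [u|w] [u'|w'].
- rewrite /= ge (inj_eq inl_inj); have [//|nu] := eqVneq u u'.
  by rewrite adj_old ?(inj_eq gI).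
- by rewrite nlr -mix.
- rewrite nrl [g' _]/= [g' _]/=.
  have adjC x y F : adj F x y = adj F y x.
    by apply: eq_existsb => Q; rewrite [(x \in Q) && _]andbC.
  by rewrite adjC -mix.
rewrite (inj_eq inr_inj) -val_eqE -adj_new //.
by apply: contraNN (hnC w) => /adj_cover[].
Qed.

End Pieces.

(** * Cycle subgraphs *)

Lemma set2_eq (V : finType) (a b c d : V) : [set a; b] = [set c; d] ->
  a = c /\ b = d \/ a = d /\ b = c.
Proof.
move=> E; have aE : a \in [set c; d] by rewrite -E set21.
have bE : b \in [set c; d] by rewrite -E set22.
have cE : c \in [set a; b] by rewrite E set21.
have dE : d \in [set a; b] by rewrite E set22.
move: aE bE cE dE; rewrite !inE.
move=> /orP[]/eqP-> /orP[]/eqP->; rewrite ?orbb => /eqP ec /eqP ed; subst; auto.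
Qed.

Lemma next_nth_mod (V : eqType) (x0 : V) s i : uniq s -> i < size s ->
  next s (nth x0 s i) = nth x0 s (i.+1 %% size s).
Proof.
case: s => // y s us lti; rewrite next_nth mem_nth // index_uniq //=.
move: lti; rewrite ltnS leq_eqVlt => /predU1P[->|lti].
  by rewrite modnn nth_default.
by rewrite modn_small ?ltnS //= (set_nth_default x0).
Qed.

(** Otherwise two steps along [s] would return to the start, and 2 would vanish modulo [size s]. *)
Lemma next_neq_prev (V : eqType) (s : seq V) x : uniq s -> 2 < size s -> x \in s ->
  next s x != prev s x.
Proof.
move=> us gt2 xs; apply/eqP => E; have lti := xs; rewrite -index_mem in lti.
have : next s (next s (nth x s (index x s))) = nth x s (index x s).
  by rewrite nth_index // E next_prev.
have gt0 : 0 < size s by apply: leq_trans gt2.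
rewrite !next_nth_mod ?ltn_mod // => /eqP.
rewrite nth_uniq ?ltn_mod // -addn1 modnDml addn1 -addn2.
rewrite -[X in _ == X](modn_small lti) -[X in _ == X %[mod _]]addn0 eqn_modDl.
by rewrite mod0n modn_small.
Qed.

Definition next_edges (V : finType) (s : seq V) : {set {set V}} :=
  [set [set x; next s x] | x in s].

Lemma next_edgesP (V : finType) (s : seq V) a b : uniq s ->
  [set a; b] \in next_edges s <-> a \in s /\ (b = next s a \/ b = prev s a).
Proof.
move=> us; split=> [/imsetP[x xs /set2_eq[[-> ->]|[-> ->]]]|[as_ [->|->]]].
- by auto.
- by rewrite mem_next prev_next; auto.
- by apply/imsetP; exists a.
by apply/imsetP; exists (prev s a); rewrite ?mem_prev // next_prev // setUC.
Qed.

Section SubgraphCycles.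
Variable G : sgraph.
Implicit Types (S T : subgraph G) (s : seq G).

Lemma subgraph_eq S T : sub_vertices S = sub_vertices T ->
  sub_edges S = sub_edges T -> S = T.
Proof.
case: S T => [U E p q] [U' E' p' q'] /= eU eE; subst.
by rewrite (bool_irrelevance p p') (bool_irrelevance q q').
Qed.

Lemma sub_edge_edge S a b : [set a; b] \in sub_edges S -> edge a b.
Proof. by move/(subsetP (sub_edgesP S)); rewrite edgesP. Qed.

Lemma sub_edge_ends S a b : [set a; b] \in sub_edges S ->
  a \in sub_vertices S /\ b \in sub_vertices S.
Proof.
move=> ab; have /forall_inP/(_ _ ab)/subsetP h := sub_endsP S.
by split; apply: h; rewrite !inE eqxx ?orbT.
Qed.

Lemma sub_edge_pair S e : e \in sub_edges S -> exists a b, e = [set a; b].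
Proof. by move/(subsetP (sub_edgesP S))/imsetP => [[a b] _ ->]; exists a, b. Qed.

Lemma is_cycle_next_edges S : is_cycle S -> exists s, [/\ uniq s, 2 < size s,
  sub_vertices S = [set x in s] & sub_edges S = next_edges s].
Proof.
case=> n gt2 [f [g fK gK] fE].
pose h (i : 'I_n) := val (g i).
have hI : injective h by move=> i j /val_inj/(can_inj gK).
pose s := [seq h i | i <- enum 'I_n].
have us : uniq s by rewrite map_inj_uniq ?enum_uniq.
have hs i : h i \in s by rewrite map_f ?mem_enum.
have hnext i : next s (h i) = h (ordS i).
  have lti : i < size (enum 'I_n) by rewrite size_enum_ord.
  rewrite next_map //; last by rewrite enum_uniq.
  rewrite -{1}(nth_ord_enum i i) next_nth_mod ?enum_uniq // size_enum_ord.
  congr h; apply: val_inj; rewrite /= nth_enum_ord ?ltn_mod //.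
  by apply: leq_trans gt2.
have hf (v : S) : h (f v) = val v by rewrite /h fK.
exists s; split=> //.
- by rewrite size_map size_enum_ord.
- apply/setP => v; rewrite inE; apply/idP/mapP => [vS|[i _ ->]]; last exact: valP (g i).
  by exists (f (Sub v vS)); rewrite ?mem_enum // hf.
apply/setP => e; apply/idP/imsetP => [eS|[_ /mapP[i _ ->] ->]].
  have [a [b eab]] := sub_edge_pair eS; rewrite eab in eS *.
  have [aS bS] := sub_edge_ends eS.
  have : edge (f (Sub a aS)) (f (Sub b bS)) by rewrite fE.
  case/andP=> _ /orP[]/eqP E.
    exists a; first by rewrite -[a]/(val (Sub a aS : S)) -hf.
    by rewrite -[a]/(val (Sub a aS : S)) -[b]/(val (Sub b bS : S)) -!hf hnext E.
  exists b; first by rewrite -[b]/(val (Sub b bS : S)) -hf.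
  rewrite -[a]/(val (Sub a aS : S)) -[b]/(val (Sub b bS : S)) -!hf hnext E.
  by rewrite setUC.
have : edge (g i) (g (ordS i)).
  rewrite -fE !gK /= /cycle_edge eqxx andbT -val_eqE /= neq_ltn.
  have := ltn_ord i; rewrite leq_eqVlt => /predU1P[E|lt].
    rewrite E modnn orbC -ltnS E (leq_trans _ gt2) //.
  by rewrite modn_small ?ltnSn.
by rewrite hnext.
Qed.

Lemma next_edges_subgraph s : ucycle edge s -> 2 < size s ->
  exists S, [/\ sub_vertices S = [set x in s], sub_edges S = next_edges s & is_cycle S].
Proof.
move=> /andP[cs us] gt2.
have sP : next_edges s \subset edges G.
  by apply/subsetP => _ /imsetP[x xs ->]; rewrite edgesP next_cycle.
have eP : [forall e in next_edges s, e \subset [set x in s]].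
  apply/forall_inP => _ /imsetP[x xs ->]; apply/subsetP => y.
  by rewrite !inE => /orP[]/eqP-> //; rewrite mem_next.
exists (Subgraph sP eP); split=> //; exists (size s) => //.
set S := Subgraph sP eP.
have [x0 _] : exists x, x \in s by case: (s) gt2 => // x ?; exists x; rewrite mem_head.
have ns (i : 'I_(size s)) : nth x0 s i \in [set x in s] by rewrite inE mem_nth.
pose g (i : 'I_(size s)) : S := Sub (nth x0 s i) (ns i).
have gI : injective g.
  move=> i j /(congr1 val)/= /eqP; rewrite nth_uniq // => /eqP; exact: val_inj.
have [f gK fK] : bijective g.
  apply: inj_card_bij gI _.
  by rewrite card_ord card_sig cardsE; apply: card_size.
exists f; first by exists g.
move=> x y; rewrite -{2}(fK x) -{2}(fK y); move: (f x) (f y) => i j.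
apply/idP/idP => [/andP[_]|].
  move=> ij; apply/next_edgesP => //; rewrite /= mem_nth //; split=> //.
  case/orP: ij => /eqP->; [left | right]; rewrite /= -next_nth_mod //.
  by rewrite prev_next.
case/next_edgesP=> //= _ E; rewrite /cycle_edge; apply/andP; split.
  apply/eqP => ij; have := edge_irrefl (nth x0 s i).
  have ne : edge (nth x0 s i) (next s (nth x0 s i)) by rewrite next_cycle ?mem_nth.
  have pe : edge (prev s (nth x0 s i)) (nth x0 s i) by rewrite prev_cycle ?mem_nth.
  by case: E; rewrite -ij => E; [rewrite -E in ne; rewrite ne | rewrite -E in pe; rewrite pe].
have lt k : k.+1 %% size s < size s by rewrite ltn_mod (leq_trans _ gt2).
case: E => E; apply/orP; [left | right]; apply/eqP/val_inj/eqP => /=.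
  by rewrite -(nth_uniq x0 _ (lt i) us) // E next_nth_mod.
by rewrite -(nth_uniq x0 _ (lt j) us) // -next_nth_mod // E next_prev.
Qed.

(** At a vertex of [S] the two distinct neighbours in [S] already exhaust the neighbours in [T], so
    the traversal of [T] never leaves [S]. *)
Lemma is_cycle_le S T : subgraph_le S T -> is_cycle S -> is_cycle T -> S = T.
Proof.
move=> [_ sE] /is_cycle_next_edges[s [us gs Vs Es]] /is_cycle_next_edges[k [uk gk Vk Ek]].
rewrite Es Ek in sE.
have key x : x \in s -> next k x = next s x \/ next k x = prev s x.
  move=> xs; have /(next_edgesP _ _ uk)[_ n1] : [set x; next s x] \in next_edges k.
    by apply: (subsetP sE); apply/next_edgesP; auto.
  have /(next_edgesP _ _ uk)[_ p1] : [set x; prev s x] \in next_edges k.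
    by apply: (subsetP sE); apply/next_edgesP; auto.
  case: n1; auto; case: p1; auto => p1 n1.
  by have := next_neq_prev us gs xs; rewrite n1 p1 eqxx.
have ks x : x \in s -> next k x \in s.
  by move=> xs; case: (key x xs) => ->; rewrite ?mem_next ?mem_prev.
have sk : {subset s <= k}.
  by move=> x xs; have /(next_edgesP _ _ uk)[] := subsetP sE _ (imset_f (fun x => [set x; next s x]) xs).
have {}ks : {subset k <= s}.
  have [x xs] : exists x, x \in s by case: (s) gs => // x ?; exists x; rewrite mem_head.
  move=> y; rewrite -(fconnect_cycle (cycle_next uk) (sk x xs)) => cxy.
  by apply: (connect_ind (A := fun z => z \in s)) cxy => // z z' _ zs /eqP<-; apply: ks.
apply: subgraph_eq.
  by rewrite Vs Vk; apply/setP => x; rewrite !inE; apply/idP/idP; auto.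
rewrite Es Ek; apply/eqP; rewrite eqEsubset sE /=; apply/subsetP => _ /imsetP[x xk ->].
by apply/(next_edgesP _ _ us); split; [apply: ks | apply/key/ks].
Qed.

End SubgraphCycles.

(** * Cycles of a cactus *)

(** Fixing the length of the witness to [#|Q|] makes the predicate boolean, so that [cycles] can be
    a finite set. *)
Definition cyc (G : sgraph) (Q : {set G}) : bool :=
  [exists s : #|Q|.-tuple G, [&& 2 < #|Q|, ucycleb edge s & Q == [set x in s]]].

Lemma cycP (G : sgraph) (Q : {set G}) :
  reflect (exists s, [/\ ucycle edge s, 2 < size s & Q = [set x in s]]) (cyc Q).
Proof.
apply: (iffP existsP) => [[s /and3P[gt2 us /eqP eQ]]|[s [us gt2 eQ]]].
  by exists s; split=> //; rewrite size_tuple.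
have /andP[_ uniqs] := us.
have sz : size s == #|Q| by rewrite eQ cardsE (card_uniqP uniqs).
have gtQ : 2 < #|Q| by rewrite -(eqP sz).
by exists (Tuple sz); apply/and3P; split=> //; apply/eqP.
Qed.

Lemma cyc_card (G : sgraph) (Q : {set G}) : cyc Q -> 2 < #|Q|.
Proof. by case/existsP => s /and3P[]. Qed.

Lemma cyc_imset (G H : sgraph) (pi : G -> H) (Q : {set G}) : {in Q &, injective pi} ->
  {in Q &, forall u v, edge u v -> edge (pi u) (pi v)} -> cyc Q -> cyc (pi @: Q).
Proof.
move=> inj hom /cycP[s [/andP[cs us] gt2 eQ]].
apply/cycP; exists (map pi s); split.
- apply/andP; split; last by rewrite map_inj_in_uniq // => x y xs ys; apply: inj; rewrite eQ inE.
  rewrite cycle_map; apply: (sub_in_cycle (P := fun x => x \in Q)) cs; first by move=> x y; apply: hom.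
  by apply/allP => x xs; rewrite /= eQ inE.
- by rewrite size_map.
apply/setP => w; rewrite inE; apply/imsetP/mapP => -[x xs ->]; exists x => //.
  by rewrite eQ inE in xs.
by rewrite eQ inE.
Qed.

Lemma cyc_subgraph (G : sgraph) (Q : {set G}) : cyc Q ->
  exists S : subgraph G, is_cycle S /\ sub_vertices S = Q.
Proof.
by case/cycP=> s [us gt2 ->]; have [S [? _ ?]] := next_edges_subgraph us gt2; exists S.
Qed.

Lemma next_edges_ucycle (G : sgraph) (S : subgraph G) s : uniq s ->
  sub_edges S = next_edges s -> ucycle edge s.
Proof.
move=> us Es; apply/andP; split=> //; apply: cycle_from_next => // x xs.
by apply: (@sub_edge_edge _ S); rewrite Es; apply/next_edgesP => //; split=> //; left.
Qed.

Lemma is_cycle_cyc (G : sgraph) (S : subgraph G) : is_cycle S -> cyc (sub_vertices S).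
Proof.
move=> /is_cycle_next_edges[s [us gt2 -> Es]]; apply/cycP; exists s; split=> //.
exact: next_edges_ucycle Es.
Qed.

Lemma connect_lift (T T' : finType) (f : T' -> T) (e : rel T) (e' : rel T') :
  injective f -> (forall x' y, e (f x') y -> exists2 y', f y' = y & e' x' y') ->
  forall x' y', connect e (f x') (f y') -> connect e' x' y'.
Proof.
move=> fI lift x' y' cxy.
have [z' /fI-> //] : exists2 z', f z' = f y' & connect e' x' z'.
apply: (connect_ind (A := fun y => exists2 z', f z' = y & connect e' x' z')) cxy.
  by exists x'.
move=> _ y _ [z' <- cz] /lift[w' <- ez]; exists w' => //.
exact: connect_trans cz (connect1 ez).
Qed.

Lemma n_comp_connected (T : finType) (e : rel T) : connect_sym e ->
  (forall x y, connect e x y) -> n_comp e T <= 1.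
Proof.
move=> se ce; apply/card_le1P => x; rewrite !inE => /andP[/eqP xr _] y; rewrite !inE.
apply/andP/eqP => [[/eqP yr _]|->]; last by split=> //; apply/eqP.
by rewrite -xr -yr; apply/eqP; rewrite root_connect.
Qed.

Lemma edge_connect_sym (G : sgraph) : connect_sym (@edge G).
Proof. by apply: sym_connect_sym; apply: edge_sym. Qed.

Lemma n_comp_gt0 (G : sgraph) (x : G) : 0 < num_components G.
Proof.
by apply/card_gt0P; exists (root edge x); rewrite !inE roots_root //; apply: edge_connect_sym.
Qed.

Section Family.
Variable G : sgraph.
Implicit Types (B : {set {set G}}) (Q : {set G}) (S T : subgraph G).

(** Chords of a member are kept, so that the subgraph depends on the vertex sets alone and no cyclic
    order has to be chosen. *)
Definition fam_edges B : {set {set G}} :=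
  [set e in edges G | [exists Q in B, e \subset Q]].

Fact fam_edgesP B : fam_edges B \subset edges G.
Proof. by apply/subsetP => e; rewrite inE => /andP[]. Qed.

Fact fam_endsP B : [forall e in fam_edges B, e \subset cover B].
Proof.
apply/forall_inP => e; rewrite inE => /andP[_ /exists_inP[Q QB eQ]].
exact: subset_trans eQ (bigcup_sup _ QB).
Qed.

Definition fam_subgraph B := Subgraph (fam_edgesP B) (fam_endsP B).

Lemma fam_edgeE B u v : ([set u; v] \in sub_edges (fam_subgraph B)) = edge u v && adj B u v.
Proof.
rewrite inE edgesP; congr (_ && _); apply: eq_existsb => Q.
by rewrite subUset !sub1set.
Qed.

Lemma le_fam_subgraph B S Q : Q \in B -> sub_vertices S \subset Q ->
  subgraph_le S (fam_subgraph B).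
Proof.
move=> QB SQ; split; first exact: subset_trans SQ (bigcup_sup _ QB).
apply/subsetP => e eS; rewrite inE (subsetP (sub_edgesP S) _ eS).
apply/exists_inP; exists Q => //; apply: subset_trans SQ.
exact: (forall_inP (sub_endsP S)).
Qed.

Definition avoid B w : rel G := fun x y => [&& edge x y, adj B x y, x != w & y != w].

Lemma avoid_sym B w : connect_sym (avoid B w).
Proof.
apply: sym_connect_sym => x y; rewrite /avoid edge_sym [(x != w) && _]andbC.
by congr [&& _, _ & _]; apply: eq_existsb => Q; rewrite [(x \in Q) && _]andbC.
Qed.

(** Opening the cycle at [w], or anywhere if [w] is not on it, leaves a path through all its
    vertices other than [w]. *)
Lemma cyc_avoid B Q w a b : cyc Q -> Q \in B -> a \in Q -> b \in Q ->
  a != w -> b != w -> connect (avoid B w) a b.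
Proof.
move=> /cycP[s [/andP[cs us] gt2 eQ]] QB aQ bQ aw bw.
suff [x [p [px sQ sub nw]]] : exists x p, [/\ path edge x p, {subset x :: p <= Q},
    forall y, y \in Q -> y != w -> y \in x :: p & w \notin x :: p].
  have cx y : y \in Q -> y != w -> connect (avoid B w) x y.
    move=> yQ yw; apply: (@path_connect _ _ x p) (sub y yQ yw).
    apply: (sub_in_path (P := fun y => y \in x :: p)) px; last exact/allP.
    move=> u v uP vP uv; rewrite /avoid uv /=; apply/and3P; split.
    - by apply/adjP; exists Q; split=> //; apply: sQ.
    - by apply: contraNneq nw => <-.
    by apply: contraNneq nw => <-.
  by apply: connect_trans (cx b bQ bw); rewrite avoid_sym; apply: cx.
have [ws|ws] := boolP (w \in s).
  case: (rot_to ws) => i p Er.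
  have : cycle edge (w :: p) by rewrite -Er rot_cycle.
  have : uniq (w :: p) by rewrite -Er rot_uniq.
  have Qp y : (y \in Q) = (y \in w :: p) by rewrite -Er mem_rot eQ inE.
  case: p Qp {Er} => [|x p] Qp /=.
    by move: aQ; rewrite Qp inE (negPf aw).
  case/andP=> wp _ /andP[_]; rewrite rcons_path => /andP[px _].
  exists x, p; split=> // y.
  - by rewrite Qp (in_cons w) => ->; rewrite orbT.
  by rewrite Qp (in_cons w) => /predU1P[->|//]; rewrite eqxx.
case: s cs us gt2 eQ ws => // x p; rewrite /= rcons_path => /andP[px _] _ _ eQ ws.
by exists x, p; split=> // y; rewrite eQ inE.
Qed.

Lemma fam_nonseparable B : 2 < #|cover B| ->
  (forall w a b, a \in cover B -> b \in cover B -> a != w -> b != w ->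
    connect (avoid B w) a b) ->
  nonseparable (fam_subgraph B).
Proof.
move=> gt2 cB; set H := fam_subgraph B.
have cardH : #|H| = #|cover B| by rewrite card_sig; apply: eq_card.
have conn (x y : H) : connect edge x y.
  (* Plain connectedness also follows from the hypothesis, by avoiding any third vertex; this is
     where [2 < #|cover B|] enters. *)
  have [w wB /andP[xw yw]] : exists2 w, w \in cover B & (val x != w) && (val y != w).
    have : 0 < #|cover B :\: [set val x; val y]|.
      rewrite cardsD subn_gt0 (leq_ltn_trans _ gt2) //.
      by rewrite (leq_trans (subset_leq_card (subsetIr _ _))) // cards2; case: eqP.
    by case/card_gt0P=> w; rewrite !inE negb_or ![w == _]eq_sym => /andP[? ?]; exists w.
  apply: (connect_lift (f := val)) (cB w _ _ (valP x) (valP y) xw yw); first exact: val_inj.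
  move=> x' y' /and4P[xy /[dup] /adj_cover[_ yB] axy _ _].
  by exists (Sub y' yB) => //; rewrite [edge _ _]fam_edgeE xy.
split.
- by split=> //; rewrite cardH (leq_trans _ gt2).
- by rewrite cardH (leq_trans _ gt2).
move=> w; rewrite /cut_vertex ltnNge => /negP; apply.
apply: leq_trans (n_comp_gt0 w); apply: n_comp_connected.
  exact: edge_connect_sym.
move=> x y; have nw (z : remove [set w]) : val (val z) != val w.
  by have := valP z; rewrite inE.
apply: (connect_lift (f := fun z => val (val z)))
  (cB (val w) _ _ (valP (val x)) (valP (val y)) (nw x) (nw y)).
  by move=> a b /val_inj/val_inj.
move=> x' y' /and4P[xy /[dup] /adj_cover[_ yB] axy _ yw].
have yw' : (Sub y' yB : H) \notin [set w] by rewrite inE -val_eqE.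
by exists (Sub (Sub y' yB : H) yw') => //; rewrite [edge _ _]fam_edgeE xy.
Qed.

(** [P] need not be decidable, so the choice between maximal and enlargeable is classical. The
    number of vertices plus edges grows at each enlargement and is bounded. *)
Lemma maximal_subgraph_exists (P : sgraph -> Prop) S : P S ->
  exists2 T, subgraph_le S T & maximal_subgraph P T.
Proof.
pose size T := #|sub_vertices T| + #|sub_edges T|.
pose bound := #|G| + #|{set G}|.
have le_bound T : size T <= bound by rewrite leq_add // max_card.
elim: {S}_.+1 {-2}S (ltnSn (bound - size S)) => // n IH S; rewrite ltnS => leS PS.
have [max|] := classic (maximal_subgraph P S); first by exists S.
case/not_and_or=> // /not_all_ex_not[T] nT.
have [leST nT'] := imply_to_and _ _ nT; have [PT neT] := imply_to_and _ _ nT'.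
have [||U leTU maxU] := IH T; last 1 first.
- exists U => //; split; [apply: subset_trans (proj1 leTU) | apply: subset_trans (proj2 leTU)]; apply leST.
- have [le1 le2] := leST; apply: leq_trans leS.
  have : size S < size T.
    rewrite ltn_neqAle leq_add ?subset_leq_card // andbT; apply/negP => /eqP E.
    case: neT; apply/esym/subgraph_eq; apply/eqP; rewrite eqEcard ?le1 ?le2 /=.
      by rewrite -(leq_add2r #|sub_edges S|) [X in _ <= X]E leq_add2l subset_leq_card.
    by rewrite -(leq_add2l #|sub_vertices S|) [X in _ <= X]E leq_add2r subset_leq_card.
  by move=> lt; apply: ltn_sub2l => //; apply: leq_trans lt (le_bound _).
by [].
Qed.

Hypothesis G_cactus : cactus G.

(** The union of [B] is nonseparable, hence lies in one block. That block has more than two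
    vertices, so it is a cycle, and both [S] and [T] fill it by [is_cycle_le]. *)
Lemma cycle_unique B S T Q R : {in B, forall Q', cyc Q'} ->
  (forall w a b, a \in cover B -> b \in cover B -> a != w -> b != w ->
    connect (avoid B w) a b) ->
  Q \in B -> R \in B -> sub_vertices S = Q -> sub_vertices T = R ->
  is_cycle S -> is_cycle T -> S = T.
Proof.
move=> cycB cB QB RB SQ TR cS cT.
have gt2 : 2 < #|cover B|.
  by apply: leq_trans (cyc_card (cycB _ QB)) (subset_leq_card (bigcup_sup _ QB)).
have [K leK maxK] := maximal_subgraph_exists (fam_nonseparable gt2 cB).
have le U Q' : Q' \in B -> sub_vertices U = Q' -> subgraph_le U K.
  move=> Q'B UQ; have sUQ : sub_vertices U \subset Q' by rewrite UQ.
  have [le1 le2] := le_fam_subgraph Q'B sUQ.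
  split; [exact: subset_trans le1 (proj1 leK) | exact: subset_trans le2 (proj2 leK)].
have leS := le _ _ QB SQ; have leT := le _ _ RB TR.
have [[f fb _]|cK] := G_cactus maxK.
  have := leq_trans (cyc_card (cycB _ QB)) _; rewrite -SQ => /(_ _ (subset_leq_card (proj1 leS))).
  have -> : #|sub_vertices K| = #|K| by rewrite card_sig; apply: eq_card.
  by rewrite (bij_eq_card fb) card_ord.
by rewrite (is_cycle_le leS cS cK) (is_cycle_le leT cT cK).
Qed.

Lemma chain_avoid B w x p : {in B, forall Q, cyc Q} -> path (adj B) x p ->
  w \notin x :: p -> connect (avoid B w) x (last x p).
Proof.
move=> cycB; elim: p x => [|y p IH] x /=; first by rewrite connect0.
case/andP=> /adjP[Q [QB xQ yQ]] py; rewrite inE negb_or => /andP[wx wyp].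
apply: connect_trans (IH y py wyp); apply: (cyc_avoid (cycB _ QB) QB) => //.
  by rewrite eq_sym.
by move: wyp; rewrite inE negb_or eq_sym => /andP[].
Qed.

Definition cycles : {set {set G}} := [set Q | cyc Q].

Lemma cactus_berge : berge cycles.
Proof.
move=> Q u v; rewrite inE => cQ uQ vQ /connectP[p0 ep0 ev0].
apply/eqP/negPn/negP => nuv.
move: ev0; case/shortenP: ep0 => p ep up _ ev {p0}.
(* Taking every other cycle that meets the path in two vertices avoids choosing one per link. Having
   two such vertices lets an added cycle reach the path whichever vertex is avoided. *)
pose B := Q |: [set R in cycles :\ Q |
  [exists x, exists y, [&& x != y, x \in u :: p, y \in u :: p, x \in R & y \in R]]].
have cycB : {in B, forall R, cyc R}.
  by move=> R; rewrite !inE => /predU1P[->|/andP[/andP[_]]].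
have QB : Q \in B by rewrite setU11.
have linkB x y : x \in u :: p -> y \in u :: p -> x != y -> adj (cycles :\ Q) x y ->
    exists R, [/\ R \in B, R != Q, x \in R & y \in R].
  move=> xp yp nxy /adjP[R [RF xR yR]]; exists R; split=> //.
    rewrite in_setU1 in_set RF; apply/orP; right.
    by apply/existsP; exists x; apply/existsP; exists y; apply/and5P.
  by case/setD1P: RF.
have epn i : i < size p -> exists R, [/\ R \in B, R != Q, nth u (u :: p) i \in R & nth u p i \in R].
  move=> lti; apply: linkB.
  - by apply: mem_nth; rewrite /= ltnS ltnW.
  - by rewrite inE mem_nth ?orbT.
  - by rewrite -[nth u p i]/(nth u (u :: p) i.+1) nth_uniq //= ?ltnS ?(ltnW lti) // neq_ltn ltnSn.
  by apply/(pathP u ep).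
have pB : path (adj B) u p.
  by apply/(pathP u) => i /epn[R [RB _ xR yR]]; apply/adjP; exists R.
(* The path repeats no vertex, so [w] misses its part up to [z] or its part from [z] on; the walk to
   [Q] ends at [u] or at [v] accordingly. *)
have toQ w z : z \in u :: p -> z != w -> exists2 q, q \in Q & q != w /\ connect (avoid B w) z q.
  move=> zp zw; case/splitPl: zp pB up ev => p1 p2 ez.
  rewrite cat_path last_cat ez => /andP[pB1 pB2] up ev.
  have [wp|wp] := boolP (w \in u :: p1); last first.
    exists u => //; split; first by apply: contraNneq wp => <-; rewrite mem_head.
    by rewrite avoid_sym -ez; apply: chain_avoid.
  have wp2 : w \notin z :: p2.
    rewrite inE negb_or eq_sym zw; move: up; rewrite -cat_cons cat_uniq => /and3P[_ /hasPn nw _].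
    by apply: contraTN wp => /nw.
  exists v => //; split; last by rewrite ev; apply: chain_avoid.
  by apply: contraNneq wp2 => <-; rewrite ev mem_last.
have coverQ w a : a \in cover B -> a != w -> exists2 q, q \in Q & q != w /\ connect (avoid B w) a q.
  case/bigcupP=> R RB aR aw; have cR := cycB _ RB.
  move: (RB); rewrite in_setU1 => /predU1P[eR|].
    by exists a; rewrite -?eR.
  rewrite in_set => /andP[_ /existsP[x /existsP[y /and5P[nxy xp yp xR yR]]]].
  have [z [zp zR zw]] : exists z, [/\ z \in u :: p, z \in R & z != w].
    have [xw|xw] := eqVneq x w; last by exists x.
    by exists y; split=> //; rewrite -xw eq_sym.
  have [q qQ [qw cq]] := toQ w z zp zw; exists q => //; split=> //.
  by apply: connect_trans cq; apply: (cyc_avoid cR RB).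
have cB w a b : a \in cover B -> b \in cover B -> a != w -> b != w -> connect (avoid B w) a b.
  move=> aB bB aw bw; have [q qQ [qw cq]] := coverQ w a aB aw.
  have [q' q'Q [q'w cq']] := coverQ w b bB bw.
  apply: connect_trans cq _; apply: connect_trans (_ : connect _ q' _).
    exact: (cyc_avoid cQ QB).
  by rewrite avoid_sym.
have [R [RB nRQ _ _]] : exists R, [/\ R \in B, R != Q, nth u (u :: p) 0 \in R & nth u p 0 \in R].
  by apply: epn; case: (p) ev nuv => //= ->; rewrite eqxx.
have [S [cS SQ]] := cyc_subgraph cQ; have [T [cT TR]] := cyc_subgraph (cycB _ RB).
by case/eqP: nRQ; rewrite -SQ -TR (cycle_unique cycB cB QB RB SQ TR cS cT).
Qed.

(** Replacing cycles by their vertex sets loses nothing in a cactus: two cycles on the same vertices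
    would share a block. *)
Lemma cycle_vertices_inj S T : is_cycle S -> is_cycle T ->
  sub_vertices S = sub_vertices T -> S = T.
Proof.
move=> cS cT eST; have cQ := is_cycle_cyc cS.
have Q1 : sub_vertices S \in [set sub_vertices S] by rewrite inE.
apply: (@cycle_unique [set sub_vertices S] _ _ _ _ _ _ Q1 Q1) => //.
  by move=> Q' /set1P->.
rewrite /cover big_set1 => w a b aS bS; exact: (cyc_avoid cQ Q1).
Qed.

End Family.

(** * Minimal graphs outside the class *)

(** The sizes are those for which any [k] deletions leave two cycles. In the packing case [X] is
    empty, so that [collapses] fits both cases. *)
Definition obstruction (V : finType) k (B : {set {set V}}) (X : {set V}) : Prop :=
  [/\ trivIset B, #|B| = k.+2 & X = set0] \/ bforest k.+1 B X.

Lemma remove_cycle (G : sgraph) (Z : {set G}) (S : subgraph (remove Z)) : is_cycle S ->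
  exists S' : subgraph G, [/\ is_cycle S',
    sub_vertices S' = [set val v | v in sub_vertices S] &
    forall u v, [set u; v] \in sub_edges S <-> [set val u; val v] \in sub_edges S'].
Proof.
move=> /is_cycle_next_edges[s [us gt2 Vs Es]].
have us' : uniq (map val s) by rewrite map_inj_uniq //; apply: val_inj.
have cs : ucycle edge (map val s).
  have /andP[cs _] := next_edges_ucycle us Es.
  by apply/andP; split; rewrite ?cycle_map.
have [|S' [VS' ES' cS']] := next_edges_subgraph cs; first by rewrite size_map.
exists S'; split=> //.
  rewrite VS' Vs; apply/setP => v; rewrite inE; apply/mapP/imsetP => -[x xs ->]; exists x => //.
    by rewrite inE.
  by rewrite inE in xs.
move=> u v; rewrite Es ES' !next_edgesP // (mem_map val_inj).
rewrite (next_map val_inj) // (prev_map val_inj) //.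
by split=> -[-> E]; split=> //; case: E => E; [left|right|left|right];
  rewrite ?E //; apply: val_inj.
Qed.

(** Every cycle that survives the removal of [Z] has vertex set [c], and [cycle_vertices_inj] leaves
    room for only one. *)
Lemma hits_apex k (G : sgraph) (Z c : {set G}) : cactus G -> #|Z| <= k ->
  hits Z (cycles G :\ c) -> apex k sub_unicyclic G.
Proof.
move=> cG leZ hZ; exists Z => // S T /remove_cycle[S' [cS VS ES]] /remove_cycle[T' [cT VT ET]].
have eqc (U : subgraph (remove Z)) (U' : subgraph G) : is_cycle U' ->
    sub_vertices U' = [set val v | v in sub_vertices U] -> sub_vertices U' = c.
  move=> cU VU; apply/eqP/negPn/negP => nU.
  have /set0Pn[z /setIP[]] : sub_vertices U' :&: Z != set0.
    by apply: hZ; rewrite !inE nU is_cycle_cyc.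
  by rewrite VU => /imsetP[v _ ->]; rewrite (negPf (valP v)).
have eST : S' = T' by apply: cycle_vertices_inj; rewrite // (eqc S) // (eqc T).
apply: subgraph_eq.
  by apply: (imset_inj val_inj); rewrite -VS -VT eST.
apply/setP => e; apply/idP/idP => eS; have [a [b eab]] := sub_edge_pair eS; rewrite eab in eS *.
  by apply/ET; rewrite -eST; apply/ES.
by apply/ES; rewrite eST; apply/ET.
Qed.

(** By [hits_apex], a set meeting all cycles but one has more than [k] vertices. In the first
    alternative of the dichotomy this gives [#|X| >= k+2], hence a packing of that size; in the
    second, either [#|X| = k+1] and the butterflies serve, or the packing is again large enough. *)
Lemma cactus_obstruction k (G : sgraph) : cactus G -> ~ apex k sub_unicyclic G ->
  exists (B : {set {set G}}) (X : {set G}), [/\ {in B, forall Q, cyc Q}, berge B & obstruction k B X].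
Proof.
move=> cG napex; have bG := cactus_berge cG.
have cyc0 : set0 \notin cycles G by rewrite inE; apply/negP => /cyc_card; rewrite cards0.
have [X [M [hX sM tM cM alt]]] := berge_dichotomy bG cyc0.
have sub (B : {set {set G}}) : B \subset cycles G -> {in B, forall Q, cyc Q}.
  by move=> /subsetP sB Q /sB; rewrite inE.
have pack : k.+2 <= #|M| ->
    exists (B : {set {set G}}) (X : {set G}), [/\ {in B, forall Q, cyc Q}, berge B & obstruction k B X].
  case/card_geqP => s [us ss sM']; exists [set x in s], set0.
  have sB : [set x in s] \subset M by apply/subsetP => x; rewrite inE; apply: sM'.
  have sBG := subset_trans sB sM.
  split; [exact: sub | exact: berge_sub bG | left; split=> //].
    exact: trivIsetS tM.
  by rewrite cardsE (card_uniqP us).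
have hits_big Z c : hits Z (cycles G :\ c) -> k < #|Z|.
  by move=> hZ; rewrite ltnNge; apply/negP => leZ; apply: napex; apply: hits_apex hZ.
case: alt => [[c [Z [ltZ hZ]]]|[B [sB BX]]].
  by apply: pack; rewrite cM (leq_trans _ ltZ) // ltnS (hits_big Z c).
have : k < #|X| by apply: (hits_big _ set0) => Q /setD1P[_]; apply: hX.
rewrite leq_eqVlt => /predU1P[eX|ltX]; last by apply: pack; rewrite cM.
exists B, X; split; [exact: sub | exact: berge_sub bG | right].
by rewrite eX; apply: butterflies_bforest BX; apply: berge_sub bG.
Qed.

Lemma obstruction_not_apex k (G : sgraph) (B : {set {set G}}) (X : {set G}) : {in B, forall Q, cyc Q} ->
  obstruction k B X -> ~ apex k sub_unicyclic G.
Proof.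
move=> cB oB [Z leZ uniZ].
have [Q [R [QB RB nQR dQ dR]]] : exists Q R, [/\ Q \in B, R \in B, Q != R,
    [disjoint Q & Z] & [disjoint R & Z]].
  case: oB => [[tB cardB _]|bB]; first by apply: packing_hits; rewrite // cardB.
  by apply: (bforest_hits bB).2.
have out (A : {set G}) : [disjoint A & Z] -> {in A, forall u, u \notin Z}.
  by move=> dA u uA; rewrite (disjointFr dA).
have /card_gt0P[v vQ] : 0 < #|Q| by apply: leq_trans (cyc_card (cB _ QB)).
pose v0 : remove Z := Sub v (out Q dQ v vQ).
(* The value [v0] on [Z] is a dummy: [pi] is only applied to sets disjoint from [Z]. *)
pose pi : G -> remove Z := insubd v0.
have piK (A : {set G}) : [disjoint A & Z] -> {in A, cancel pi val}.
  by move=> dA u /(out _ dA) uZ; rewrite /pi val_insubd uZ.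
have cyc_pi (A : {set G}) : A \in B -> [disjoint A & Z] -> cyc (pi @: A).
  move=> AB dA; apply: cyc_imset (cB _ AB); first exact: can_in_inj (piK _ dA).
  by move=> x y xA yA xy; rewrite [edge _ _]/(edge (val _) (val _)) !(piK _ dA).
have [S [cS VS]] := cyc_subgraph (cyc_pi _ QB dQ).
have [T [cT VT]] := cyc_subgraph (cyc_pi _ RB dR).
have valpi (A : {set G}) : [disjoint A & Z] -> [set val v | v in pi @: A] = A.
  move=> dA; apply/setP => x; apply/imsetP/idP => [[_ /imsetP[y yA ->] ->]|xA].
    by rewrite (piK _ dA).
  by exists (pi x); rewrite ?imset_f ?(piK _ dA).
by case/eqP: nQR; rewrite -(valpi Q) // -(valpi R) // -VS -VT (uniZ S T).
Qed.

(** Used twice: with [pi] a retraction onto the subgraph spanned by [B], and with [pi] the quotient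
    map of an edge contraction. *)
Lemma collapses_not_apex k (G H : sgraph) (pi : G -> H) (B : {set {set G}}) (X : {set G}) :
  obstruction k B X -> collapses pi B X -> {in B, forall Q : {set G}, cyc (pi @: Q)} ->
  ~ apex k sub_unicyclic H.
Proof.
move=> oB col cpi; apply: (@obstruction_not_apex k H (imfam pi B) (pi @: X)).
  by move=> _ /imsetP[Q QB ->]; apply: cpi.
have gt1 Q : Q \in B -> 1 < #|pi @: Q| by move=> /cpi/cyc_card/ltnW.
case: oB => [[tB cardB X0]|bB]; last by right; apply: bforest_imfam.
left; rewrite X0 in col *; have [|tpi cpiB] := packing_imfam tB col.
  by move=> Q /gt1/ltnW.
by rewrite imset0 cpiB.
Qed.

Lemma iso_id (G : sgraph) : iso G G.
Proof. by exists id => //; exists id. Qed.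

Lemma iso_inv (G H : sgraph) (g : H -> G) : bijective g ->
  (forall a b, edge a b = edge (g a) (g b)) -> iso G H.
Proof.
case=> f gK fK gE; exists f; first by exists g.
by move=> x y; rewrite gE !fK.
Qed.

Section Minimal.
Variables (k : nat) (G : sgraph) (B : {set {set G}}) (X : {set G}).
Hypotheses (G_obs : obs (apex k sub_unicyclic) G) (B_cyc : {in B, forall Q, cyc Q})
  (B_berge : berge B) (B_obs : obstruction k B X).

Let fam_iso : iso (fam_subgraph B) G.
Proof.
have [_ Gmin] := G_obs; apply: Gmin.
  by exists (fam_subgraph B); apply/contracts_iso/iso_id.
have /set0Pn[Q QB] : B != set0.
  rewrite -card_gt0; case: B_obs => [[_ -> _]|bB] //; rewrite card_gt0.
  by apply/eqP => B0; have [_ /(_ set0)] := bforest_hits bB; rewrite cards0 => -[//|Q [?]]; rewrite B0 inE => -[].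
have /card_gt0P[v vQ] : 0 < #|Q| by apply: leq_trans (cyc_card (B_cyc QB)).
pose v0 : fam_subgraph B := Sub v (in_cover QB vQ).
pose pi : G -> fam_subgraph B := insubd v0.
have piK : {in cover B, cancel pi val}.
  by move=> u uB; rewrite /pi val_insubd uB.
apply: (collapses_not_apex (pi := pi) B_obs).
  by move=> x y xB yB /(can_in_inj piK) ->; auto.
move=> R RB; have sR x : x \in R -> x \in cover B by apply: in_cover.
apply: cyc_imset (B_cyc RB); first by move=> x y /sR xB /sR yB; apply: (can_in_inj piK).
move=> x y xR yR xy; have : edge x y && adj B x y.
  by rewrite xy; apply/adjP; exists R.
by rewrite -fam_edgeE [X in _ -> X]/(is_true ([set val _; val _] \in _)) !piK ?sR.
Qed.

Lemma minimal_cover : cover B = [set: G].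
Proof.
have [f fb _] := fam_iso; apply/eqP; rewrite eqEcard subsetT cardsT /=.
by rewrite -(bij_eq_card fb) card_sig; apply/eq_leq/eq_card.
Qed.

Lemma minimal_adj u v : edge u v -> adj B u v.
Proof.
have [f fb fE] := fam_iso; set H := fam_subgraph B in f fb fE.
(* Edges are counted as ordered pairs: [val] injects those of [H] into those of [G], and the
   isomorphism makes the numbers equal, so every edge of [G] comes from [H]. *)
pose AH := [set p : H * H | edge p.1 p.2]; pose AG := [set p : G * G | edge p.1 p.2].
have cardAG : #|AG| = #|AH|.
  rewrite -(card_imset (f := fun p : H * H => (f p.1, f p.2))) => [|[a b] [c d] [/(bij_inj fb)-> /(bij_inj fb)->] //].
  have [g fK gK] := fb.
  apply: eq_card => -[x y]; rewrite inE /=; apply/idP/imsetP => [xy|[[a b] + [-> ->]]].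
    by exists (g x, g y); [rewrite inE -fE !gK | rewrite !gK].
  by rewrite inE fE.
have /eqP eAG : [set (val p.1, val p.2) | p in AH] == AG.
  rewrite eqEcard card_imset ?cardAG ?leqnn ?andbT.
    apply/subsetP => _ /imsetP[[a b] + ->]; rewrite !inE /=.
    exact: sub_edge_edge.
  by move=> [a b] [c d] [/val_inj-> /val_inj->].
move=> uv; have : (u, v) \in AG by rewrite inE.
rewrite -eAG => /imsetP[[a b] + [-> ->]]; rewrite inE /= => ab.
have : [set val a; val b] \in sub_edges H by [].
by rewrite fam_edgeE => /andP[].
Qed.

Let center_le1 Q : Q \in B -> #|Q :&: X| <= 1.
Proof.
case: B_obs => [[_ _ ->] _|/bforest_center]; last by apply.
by rewrite setI0 cards0.
Qed.

Lemma minimal_triangle Q : Q \in B -> #|Q| = 3.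
Proof.
move=> QB; apply/eqP; rewrite eqn_leq (cyc_card (B_cyc QB)) andbT leqNgt; apply/negP => gt3.
have /cycP[s [/andP[cs us] _ eQ]] := B_cyc QB.
(* [t] is the center on [Q], or any vertex of [Q] if there is none. *)
have [t tQ tX] : exists2 t, t \in Q & forall x, x \in Q -> x \in X -> x = t.
  have [/set0Pn[t /setIP[tQ tX]]|/negPn/eqP QX0] := boolP (Q :&: X != set0).
    exists t => // x xQ xX; have /card_le1P/(_ t) := center_le1 QB.
    by rewrite inE tQ tX => /(_ isT x); rewrite !inE xQ xX => /esym/eqP.
  have /card_gt0P[t tQ] : 0 < #|Q| by apply: leq_trans gt3.
  by exists t => // x xQ xX; have := in_set0 x; rewrite -QX0 inE xQ xX.
(* The cycle is rotated so that [t] comes last; its first two vertices then avoid [X]. The condition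
   [0 < size l] keeps three vertices in [[:: a, d & l]] once [b] is merged into [a]. *)
have [a [b [d [l [cl ul Ql aX bX]]]]] : exists a b d l,
    [/\ cycle edge [:: a, b, d & l], uniq [:: a, b, d & l],
        Q = [set x in [:: a, b, d & l]] /\ 0 < size l, a \notin X & b \notin X].
  have ts : t \in s by rewrite eQ inE in tQ.
  have [i p Er] := rot_to ts; pose p' := rot 1 (t :: p).
  have sz : size s = #|Q| by rewrite eQ cardsE (card_uniqP us).
  have : 3 < size (t :: p) by rewrite -Er size_rot sz.
  have cp : cycle edge (rot 1 (t :: p)) by rewrite -Er !rot_cycle.
  have up : uniq (rot 1 (t :: p)) by rewrite -Er !rot_uniq.
  have Qp : Q = [set x in rot 1 (t :: p)].
    by apply/setP => x; rewrite eQ !inE -Er !mem_rot.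
  case: p {Er p'} cp up Qp => [|a [|b [|d l]]] //=; rewrite rot1_cons cats1 => cp up Qp _.
  exists a, b, d, (rcons l t); split=> //; first by split; rewrite ?size_rcons.
    apply/negP => aX; have eat : a = t by apply: tX => //; rewrite Qp inE mem_head.
    by move: up; rewrite eat !inE !mem_rcons !inE !eqxx !orbT.
  apply/negP => bX; have ebt : b = t by apply: tX => //; rewrite Qp !inE eqxx orbT.
  by move: up; rewrite ebt !inE !mem_rcons !inE !eqxx !orbT andbF.
case: Ql => Ql szl.
have fullP : [forall e in edges G, e \subset [set: G]].
  by apply/forall_inP => e _; apply: subsetT.
(* Minors contract edges of a subgraph, so [G] is first replaced by its full subgraph. *)
pose S1 := Subgraph (subxx (edges G)) fullP.
pose i1 (x : G) : S1 := Sub x (in_setT x).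
have i1E (x y : G) : @edge S1 (i1 x) (i1 y) = edge x y.
  exact: (edgesP x y).
have ab : edge a b by move: cl => /= /andP[].
have nab : a != b by apply: contraTneq ab => ->; rewrite edge_irrefl.
pose K := contract (i1 a) (i1 b).
have na : i1 a != i1 b by rewrite -val_eqE.
(* The default value does the merging: only [b] has no copy in [K], and it is sent to [a]. *)
pose pi (x : G) : K := insubd (Sub (i1 a) na : K) (i1 x).
pose rho x := if x == b then a else x.
have piE x : val (pi x) = i1 (rho x).
  rewrite /pi val_insubd /rho -val_eqE /=; by case: eqP.
have pi_eq x y : pi x = pi y -> rho x = rho y.
  by move=> /(congr1 val); rewrite !piE => /(congr1 val).
have pi_edge x y : edge x y -> rho x != rho y -> edge (pi x) (pi y).
  move=> xy nrho; apply/andP; split; first by apply: contraNneq nrho => /pi_eq->.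
  rewrite !piE !i1E -![i1 _ == _]val_eqE /= /rho.
  have [xb|nxb] := eqVneq x b; have [yb|nyb] := eqVneq y b.
  - by move: nrho; rewrite /rho xb yb eqxx.
  - by rewrite eqxx -xb xy orbT.
  - by rewrite eqxx -yb [edge y x]edge_sym xy !orbT.
  by rewrite xy.
have aQ : a \in Q by rewrite Ql !inE eqxx.
have bQ : b \in Q by rewrite Ql !inE eqxx orbT.
have napex : ~ apex k sub_unicyclic K.
  apply: (collapses_not_apex (pi := pi) B_obs).
    move=> x y xB yB /pi_eq; rewrite /rho.
    case: eqP => [->|_]; case: eqP => [->|_] E; auto; right; exists Q => //.
      by rewrite -E.
    by rewrite E.
  (* A member other than [Q] meets [Q] in at most one vertex, so it cannot contain both [a] and [b],
     and [pi] is injective on it. *)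
  move=> R RB; have [eRQ|nRQ] := eqVneq R Q; last first.
    have rhoI : {in R &, injective rho}.
      move=> x y xR yR; rewrite /rho.
      case: eqP => [xb|_]; case: eqP => [yb|_] E //; first by rewrite xb.
        case/eqP: nab; apply: (berge_meet B_berge RB QB) => //; first by rewrite E.
        by rewrite -xb.
      case/eqP: nab; apply: (berge_meet B_berge RB QB) => //; first by rewrite -E.
      by rewrite -yb.
    apply: cyc_imset (B_cyc RB); first by move=> x y xR yR /pi_eq; apply: rhoI.
    move=> x y xR yR xy; apply: pi_edge => //.
    by apply: contraTneq xy => /rhoI-> //; rewrite edge_irrefl.
  rewrite eRQ; apply/cycP; exists (map pi [:: a, d & l]).
  have rhon x : x != b -> rho x = x by rewrite /rho => /negPf->.
  move: ul => /= /and4P[]; rewrite !inE !negb_or => /and3P[_ ad al] /andP[bd bl] dl ul.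
  have nb x : x \in [:: d & rcons l a] -> x != b.
    apply: contraTneq => ->; rewrite inE mem_rcons inE !negb_or bd bl.
    by rewrite eq_sym nab.
  have nb' x : x \in [:: a, d & l] -> x != b.
    by move=> xl; apply: nb; move: xl; rewrite !inE mem_rcons inE orbCA.
  split; last first.
  - rewrite Ql; apply/setP => x; rewrite in_set -[_ :: _ in RHS]/(map pi [:: a, d & l]).
    apply/imsetP/mapP => -[y yl ->].
      have [->|yb] := eqVneq y b; last by exists y => //; move: yl; rewrite !inE (negPf yb).
      exists a; rewrite ?mem_head //; apply/val_inj; rewrite !piE.
      by rewrite /rho eqxx (negPf nab).
    by exists y => //; move: yl; rewrite !inE => /orP[->//|->]; rewrite !orbT.
  - by rewrite size_map.
  apply/andP; split; last first.
    rewrite -[_ :: _]/(map pi [:: a, d & l]) map_inj_in_uniq; first by rewrite /= inE negb_or ad al dl ul.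
    by move=> x y /nb' xb /nb' yb /pi_eq; rewrite !rhon.
  move: cl => /= /and3P[_ bde pl]; apply/andP; split.
    have -> : pi a = pi b.
      by apply/val_inj; rewrite !piE /rho eqxx (negPf nab).
    apply: pi_edge => //; rewrite (rhon d) ?nb ?mem_head //.
    by rewrite /rho eqxx.
  rewrite -map_rcons path_map; apply: (sub_in_path (P := fun x => x \in d :: rcons l a)) pl; last exact/allP.
  move=> x y /nb xb /nb yb xy; apply: pi_edge => //; rewrite !rhon //.
  by apply: contraTneq xy => ->; rewrite edge_irrefl.
have [_ Gmin] := G_obs; have [|f fb _] := Gmin K _ napex.
  exists S1; apply: (@contracts_step _ _ (i1 a) (i1 b)); first by rewrite i1E.
  exact/contracts_iso/iso_id.
have := bij_eq_card fb; rewrite card_sig cardC1.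
have -> : #|S1| = #|G| by rewrite card_sig -cardsT; apply: eq_card.
have gt0 : 0 < #|G| by apply/card_gt0P; exists a.
have lt : #|G|.-1 < #|G| by rewrite prednK.
by move=> E; rewrite E ltnn in lt.
Qed.

(** In general [adj B] also relates nonconsecutive vertices of a cycle; triangles have none. *)
Lemma minimal_edge u v : edge u v = (u != v) && adj B u v.
Proof.
apply/idP/andP => [uv|[nuv /adjP[Q [QB uQ vQ]]]].
  by split; [apply: contraTneq uv => ->; rewrite edge_irrefl | apply: minimal_adj].
have /cycP[s [/andP[cs us] gt2 eQ]] := B_cyc QB.
have := minimal_triangle QB; rewrite eQ cardsE (card_uniqP us) => sz.
move: uQ vQ; rewrite eQ !inE; case: s cs sz {us gt2 eQ} => [|x [|y [|z [|? ?]]]] //=.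
case/and4P=> xy yz zx _ _; rewrite !inE.
by move=> /or3P[]/eqP eu /or3P[]/eqP ev; move: nuv; rewrite eu ev ?eqxx // 1?edge_sym.
Qed.

End Minimal.

(** * Components *)

Lemma triangles_iso (G : sgraph) n (B : {set {set G}}) : trivIset B -> #|B| = n.+1 ->
  cover B = [set: G] -> (forall Q, Q \in B -> #|Q| = 3) ->
  (forall u v, edge u v = (u != v) && adj B u v) -> iso G (copies n.+1 (complete 3)).
Proof.
move=> tB cB covB card3 edgeE.
have [Q0 Q0B] : exists Q, Q \in B by apply/card_gt0P; rewrite cB.
have := enum_card Q0B; rewrite cB => -[q [qI qB _]].
have qinB i : q i \in B by apply/qB; exists i.
have g_ex i : exists g : 'I_3 -> G, injective g /\ forall v, v \in q i <-> exists j, g j = v.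
  have /card_gt0P[t tq] : 0 < #|q i| by rewrite card3.
  by have := enum_card tq; rewrite card3 // => -[g [gI gq _]]; exists g.
have [g gP] := fin_all_exists g_ex.
have gin i j : g i j \in q i by apply/(gP i).2; exists j.
have same i i' u : u \in q i -> u \in q i' -> i = i'.
  move=> ui ui'; apply/eqP/negPn/negP => ni.
  have nq : q i != q i' by rewrite (inj_eq qI).
  by have /disjointFr := trivIsetP tB _ _ (qinB i) (qinB i') nq; move/(_ u ui); rewrite ui'.
pose h (p : copies n.+1 (complete 3)) := g p.1 p.2.
have hI : injective h.
  move=> [i j] [i' j'] E; have {}E : g i j = g i' j' := E.
  have ei : i = i' by apply: (same _ _ (g i j)); rewrite // E.
  by move: E; rewrite -ei => /(gP i).1->.
have hS v : exists p, h p = v.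
  have /bigcupP[Q QB vQ] : v \in cover B by rewrite covB.
  have [i eQ] := (qB Q).1 QB; rewrite -eQ in vQ.
  by have [j <-] := ((gP i).2 v).1 vQ; exists (i, j).
apply: (@iso_inv _ _ h).
  have [f hf] := fin_all_exists hS.
  by exists f => // p; apply: hI.
move=> [i j] [i' j']; rewrite edgeE (inj_eq hI) /= /copies_edge /=.
have -> : adj B (h (i, j)) (h (i', j')) = (i == i').
  apply/adjP/eqP => [[Q [/qB[i0 <-] u1 u2]]|<-].
    by rewrite (same _ _ _ (gin i j) u1) (same _ _ _ (gin i' j') u2).
  by exists (q i); split; rewrite // gin.
rewrite /complete_edge xpair_eqE andbC negb_and.
by case: (i == i'); rewrite ?andbF.
Qed.

Lemma connect_hom (T T' : finType) (f : T -> T') (e : rel T) (e' : rel T') :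
  (forall x y, e x y -> e' (f x) (f y)) ->
  forall x y, connect e x y -> connect e' (f x) (f y).
Proof.
move=> hom x y; apply: (connect_ind (A := fun y => connect e' (f x) (f y))) => // a b _ xa ab.
exact: connect_trans xa (connect1 (hom _ _ ab)).
Qed.

Lemma butterfly_connected (x y : butterfly) : connect edge x y.
Proof.
have to_center (z : butterfly) : connect edge butterfly_center z.
  have [->|nz] := eqVneq z butterfly_center; first exact: connect0.
  apply: connect1; case: z nz => [i|w] ni /=; first by rewrite eq_sym in ni.
  by rewrite /complete_edge eq_sym (valP w).
by apply: connect_trans (to_center y); rewrite edge_connect_sym.
Qed.

Lemma butterfly_tree_connected k (G : sgraph) (C : {set G}) :
  butterfly_tree k C -> forall x y : G, connect edge x y.
Proof.
elim=> {k G C} [|k G C v z _ IH _ _]; first exact: butterfly_connected.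
have to_v (x : identify v z) : connect edge (inl v : identify v z) x.
  case: x => [u|w]; first exact: (connect_hom (f := inl)) (IH v u).
  (* [phi] is the new butterfly inside the glued graph, with [z] sent to [v]. *)
  pose phi (a : butterfly) : identify v z :=
    if insub a is Some w then inr w else inl v.
  have <- : phi z = inl v by rewrite /phi insubF ?eqxx.
  have <- : phi (val w) = inr w by rewrite /phi valK.
  apply: connect_hom (butterfly_connected _ _) => a b ab; rewrite /phi.
  case: insubP => [a' _ ea|/negPn/eqP ea]; case: insubP => [b' _ eb|/negPn/eqP eb].
  - by rewrite [edge _ _]/(edge (val a') (val b')) ea eb.
  - by apply/andP; split=> //; rewrite edge_sym ea -eb.
  - by apply/andP; split=> //; rewrite eb -ea.
  by move: ab; rewrite ea eb edge_irrefl.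
by move=> x y; apply: connect_trans (to_v y); rewrite edge_connect_sym.
Qed.

Lemma butterfly_tree_gt0 k (G : sgraph) (C : {set G}) : butterfly_tree k C -> 0 < k.
Proof. by case. Qed.

Section Components.
Variables (G : sgraph) (B : {set {set G}}) (X : {set G}) (Ds : {set {set G}}).
Hypotheses (Ds_triv : trivIset Ds) (Ds_cover : cover Ds = [set: G])
  (Ds_sub : forall Q, Q \in B -> exists2 D, D \in Ds & Q \subset D)
  (Ds_piece : forall D, D \in Ds -> zpiece B X D)
  (edgeE : forall u v : G, edge u v = (u != v) && adj B u v).

Lemma piece_closed (D : {set G}) u v : D \in Ds -> edge u v -> u \in D -> v \in D.
Proof.
move=> DDs; rewrite edgeE => /andP[_ /adjP[Q [/Ds_sub[E EDs /subsetP QE] uQ vQ]]] uD.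
have [<-|nDE] := eqVneq E D; first exact: QE.
by have /disjointFr := trivIsetP Ds_triv _ _ EDs DDs nDE; move/(_ u (QE _ uQ)); rewrite uD.
Qed.

Lemma connected_sub_piece (D : {set G}) (S : subgraph G) u : D \in Ds -> connected S ->
  u \in sub_vertices S -> u \in D -> sub_vertices S \subset D.
Proof.
move=> DDs [_ cS] uS uD; apply/subsetP => v vS.
have := cS (Sub u uS) (Sub v vS).
apply: (connect_ind (A := fun w : S => val w \in D)) => // x y _ xD xy.
by apply: (piece_closed DDs) xD; apply: sub_edge_edge xy.
Qed.

(** With [D] as the only member, [fam_subgraph] is the subgraph of [G] induced on [D]. *)
Definition piece_graph (D : {set G}) : subgraph G := fam_subgraph [set D].

Lemma piece_vertices (D : {set G}) : sub_vertices (piece_graph D) = D.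
Proof. by rewrite /= /cover big_set1. Qed.

Lemma le_piece_graph (D : {set G}) (S : subgraph G) : sub_vertices S \subset D ->
  subgraph_le S (piece_graph D).
Proof. by apply: le_fam_subgraph; rewrite inE. Qed.

Lemma piece_copy (D : {set G}) : D \in Ds -> exists (H : sgraph) (C : {set H}) (g : H -> piece_graph D),
  [/\ @butterfly_tree #|X :&: D| H C, bijective g &
      forall a b, edge a b = edge (g a) (g b)].
Proof.
move=> /Ds_piece[H [C [g [bt gI gD _ gE]]]].
have gin a : g a \in sub_vertices (piece_graph D) by rewrite piece_vertices; apply/gD; exists a.
pose h a : piece_graph D := Sub (g a) (gin a).
have hI : injective h by move=> a b /(congr1 val)/gI.
have sD x : x \in sub_vertices (piece_graph D) -> x \in D by rewrite piece_vertices.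
have hS v : exists a, h a = v.
  have [a ga] := (gD (val v)).1 (sD _ (valP v)).
  by exists a; apply/val_inj.
have [f hf] := fin_all_exists hS.
exists H, C, h; split=> //; first by exists f => // p; apply: hI.
move=> a b; rewrite [RHS](fam_edgeE [set D]) edgeE gE.
rewrite /= (inj_eq gI) -andbA; congr (_ && _); rewrite andb_idr // => _.
by apply/adjP; exists D; split; rewrite ?inE //; apply/gD; [exists a | exists b].
Qed.

Lemma piece_connected (D : {set G}) : D \in Ds -> connected (piece_graph D).
Proof.
move=> DDs; have [H [C [g [bt gb gE]]]] := piece_copy DDs.
(* At least one butterfly is present, so [D] contains a center and is nonempty, as [connected]
   demands. *)
have cH := butterfly_tree_connected bt; have /card_gt0P[t /setIP[_ tD]] := butterfly_tree_gt0 bt.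
split; first by apply/card_gt0P; rewrite -(piece_vertices D) in tD; exists (Sub t tD).
have [f gK fK] := gb; move=> x y; rewrite -(fK x) -(fK y).
by apply: connect_hom (cH _ _) => a b; rewrite gE.
Qed.

Lemma piece_component (D : {set G}) : D \in Ds -> component (piece_graph D).
Proof.
move=> DDs; have cD := piece_connected DDs; split=> // T [leV leE] cT.
have [/card_gt0P[[u uD] _] _] := cD.
have TD : sub_vertices T \subset D.
  by apply: (@connected_sub_piece _ _ u) => //; [apply: (subsetP leV) | rewrite -(piece_vertices D)].
have [leV' leE'] := le_piece_graph TD.
by apply: subgraph_eq; apply/eqP; rewrite eqEsubset ?leV ?leV' ?leE ?leE'.
Qed.

Lemma component_piece (S : subgraph G) : component S ->
  exists2 D, D \in Ds & S = piece_graph D.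
Proof.
move=> [cS maxS]; have [/card_gt0P[[u uS] _] _] := cS.
have /bigcupP[D DDs uD] : u \in cover Ds by rewrite Ds_cover.
exists D => //; apply/esym/maxS; last exact: piece_connected.
exact/le_piece_graph/(connected_sub_piece DDs cS uS uD).
Qed.

(** The number attached to a component is its number of centers. Each center lies in exactly one
    component, so exchanging the two sums counts [X] once. *)
Lemma components_Zclass r (Gs : 'I_r -> subgraph G) : injective Gs ->
  (forall S : subgraph G, component S <-> exists i, Gs i = S) ->
  exists ks : 'I_r -> nat,
    (forall i, 0 < ks i /\ Zclass (ks i) (Gs i)) /\ \sum_(i < r) ks i = #|X|.
Proof.
move=> GsI GsC; have GsD i : exists2 D, D \in Ds & Gs i = piece_graph D.
  by apply/component_piece/GsC; exists i.
exists (fun i => #|X :&: sub_vertices (Gs i)|); split.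
  move=> i; have [D DDs ->] := GsD i; rewrite piece_vertices.
  have [H [C [g [bt gb gE]]]] := piece_copy DDs.
  by split; [apply: butterfly_tree_gt0 bt | exists H, C; split; last exact: iso_inv gE].
transitivity (\sum_(i < r) \sum_(x in X) (x \in sub_vertices (Gs i) : nat)).
  apply: eq_bigr => i _; rewrite -sum1_card big_mkcond [RHS]big_mkcond /=.
  by apply: eq_bigr => x _; rewrite inE; case: (x \in X).
rewrite exchange_big -sum1_card; apply: eq_bigr => x _ /=.
have /bigcupP[D DDs xD] : x \in cover Ds by rewrite Ds_cover.
have [i eGi] := (GsC _).1 (piece_component DDs).
rewrite (bigD1 i) //= eGi piece_vertices xD big1 // => j nji.
apply/eqP; rewrite eqb0; apply: contraNN nji => xj.
have [E EDs eGj] := GsD j; rewrite eGj piece_vertices in xj.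
apply/eqP/GsI; rewrite eGi eGj; congr piece_graph; apply/eqP/negPn/negP => nED.
by have /disjointFr := trivIsetP Ds_triv _ _ EDs DDs nED; move/(_ x xj); rewrite xD.
Qed.

End Components.

Theorem theorem21 (k : nat) (G : sgraph)
  (G_disconnected : ~ connected G)
  (G_cactus : cactus G)
  (G_obs : obs (apex k sub_unicyclic) G)
  (r : nat) (Gs : 'I_r -> subgraph G)
  (Gs_inj : injective Gs)
  (Gs_components : forall S : subgraph G, component S <-> exists i : 'I_r, Gs i = S) :
  iso G (copies k.+2 (complete 3)) \/
  exists ks : 'I_r -> nat,
    (forall i : 'I_r, 0 < ks i /\ Zclass (ks i) (Gs i)) /\
    \sum_(i < r) ks i = k.+1.
Proof.
have [B [X [B_cyc B_berge B_obs]]] := cactus_obstruction G_cactus (proj1 G_obs).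
have covB := minimal_cover G_obs B_cyc B_obs.
have card3 := minimal_triangle G_obs B_cyc B_berge B_obs.
have edgeE := minimal_edge G_obs B_cyc B_berge B_obs.
case: B_obs => [[tB cB _]|bB]; [left | right].
  exact: triangles_iso tB cB covB card3 edgeE.
have [Ds [tDs covDs subDs zDs]] := bforest_pieces bB card3.
rewrite covB in covDs; rewrite -(bforest_card bB).
exact: components_Zclass tDs covDs subDs zDs edgeE _ _ Gs_inj Gs_components.
Qed.
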